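(* Suppose $\max_{1\le i\le m}p_i=o((\ln n)^{-1})$, and let $a_n=S_{1,2}/S_1$. If $S_1=n(\ln n+\ln\ln n+c_n)$, then $\lim_{n\to\infty}\Pr\{\mathcal G(n,m,\overline p)\text{ has a Hamilton cycle}\}=0$ when $c_n\to-\infty$ and $a_n\to a\in(0,1]$, and $=1$ when $c_n\to\infty$.
   Context: All limits are as $n\to\infty$. Let $\mathcal V=\{v_1,\dots,v_n\}$, $m=m(n)$, $\overline p=\overline p(n)=(p_1,\dots,p_m)$ with $p_i\in(0,1)$. The random intersection graph $\mathcal G(n,m,\overline p)$ has vertex set $\mathcal V$; each vertex $v$ adds feature $w_i$ ($1\le i\le m$) to its feature set $W(v)$ independently with probability $p_i$ (independently over all vertices and features), and distinct $v,v'$ are adjacent iff $W(v)\cap W(v')\ne\emptyset$. Define $S_1=\sum_{i=1}^m np_i(1-(1-p_i)^{n-1})$ and $S_{1,2}=\sum_{i=1}^m 2\binom n2 p_i^2(1-p_i)^{n-2}$. *)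

(* Defs.v *)
From mathcomp Require Import all_boot all_order all_algebra.
From mathcomp Require Import all_classical all_reals all_analysis.

Set Implicit Arguments.
Unset Strict Implicit.
Unset Printing Implicit Defensive.

Import Order.TTheory GRing.Theory Num.Theory.

Local Open Scope ring_scope.

(* A duplicate-free tuple of size #|T| lists every vertex exactly once; the
   lower bound excludes the degenerate closed walks on at most two vertices. *)
Definition has_hamilton_cycle (T : finType) (e : rel T) : bool :=
  (3 <= #|T|)%N && [exists s : #|T|.-tuple T, ucycleb e s].

Section RandomIntersectionGraph.
Variables (R : realType) (n m : nat) (p : 'I_m -> R).
Implicit Types W : {ffun 'I_n -> {set 'I_m}}.

Definition intersection_graph W : rel 'I_n :=
  [rel v v' | (v != v') && (W v :&: W v' != finset.set0)].

(* Law of the feature assignment: the events i \in W v are independent over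
   all pairs (v, i), and have probability p i. *)
Definition feature_weight W : R :=
  \prod_v \prod_i (if i \in W v then p i else 1 - p i).

Lemma feature_weight_sum1 : \sum_W feature_weight W = 1.
Proof.
rewrite /feature_weight.
rewrite -(bigA_distr_bigA (fun (_ : 'I_n) (A : {set 'I_m}) =>
  \prod_i (if i \in A then p i else 1 - p i))).
rewrite big1 // => v _.
transitivity (\prod_i (p i + (1 - p i))).
  by rewrite bigA_distr; apply: eq_bigl => A; rewrite inE.
rewrite big1 // => i _.
by rewrite subrKC.
Qed.

Definition rig_prob (E : pred (rel 'I_n)) : R :=
  \sum_(W | E (intersection_graph W)) feature_weight W.

Definition S1 : R := \sum_i n%:R * p i * (1 - (1 - p i) ^+ (n - 1)).

Definition S12 : R :=
  \sum_i 2 * 'C(n, 2)%:R * p i ^+ 2 * (1 - p i) ^+ (n - 2).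

End RandomIntersectionGraph.

Arguments rig_prob {R} n {m} p E.
Arguments S1 {R} n {m} p.
Arguments S12 {R} n {m} p.

(* Main.v *)
(* A feature assignment is compared with uniform random blocks. Only the sizes
   of the vertex sets A_i of the features matter for the law up to independent
   permutations, and k uniform samples cover at most k vertices; so the graph
   dominates the one in which A_i is cut into pairs (and one triple when |A_i|
   is odd) and every block is filled with uniform vertices. The number of slots
   concentrates around S1 because max p_i = o(1 / ln n).

   Upper part: the blocks are exposed in two rounds. In the first round, with
   n (ln n + ln ln n + C) slots, a union bound over a minimal set S violating
   |N[S]| >= 3 |S| shows that the graph is an expander with probability close
   to 1. By Posa's rotations a connected expander without Hamilton cycle has at
   least n^2 / 16 ordered pairs whose addition lengthens a longest path or
   closes a Hamilton cycle, so that linearly many further pairs suffice.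

   Lower part: by a second moment computation some vertex has at most one
   neighbour. *)
Require Import Defs.
From mathcomp Require Import all_boot all_order all_algebra.
From mathcomp Require Import boolp reals sequences exp zify ring lra.

Set Implicit Arguments.
Unset Strict Implicit.
Unset Printing Implicit Defensive.

(** * Rotations and longest paths *)

(** Single vertices decide the threshold. About [n * expR (- S1 / n)] vertices share no feature with
    anyone; the extra [ln (ln n)] comes from vertices whose only useful feature is held by exactly
    two vertices. Such features are what [S12] counts, and [a > 0] says that they make up a positive
    fraction of the slots. The same two situations, one vertex with closed neighbourhood of size 1
    or 2, give the main term of the union bound in the upper part; all larger sets are polynomially
    rarer. The bound [max p = o(1 / ln n)] acts twice. The slot number has a second moment bound of
    order [S1 * (2 + n * max p)], to be beaten by the square of a deviation of order [n] while [S1]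
    is about [n ln n]. And in the lower part a product of factors [1 - x_i] with [\sum_i x_i] of
    order [ln n] has to agree with [expR (- \sum_i x_i)] up to a constant. No speed is prescribed
    for [c_n], and there is no reduction to slowly varying [c_n]: the quantitative bounds are
    arranged to hold for arbitrarily large or small [S1]. *)

Definition is_path (V : eqType) (e : rel V) (s : seq V) : bool :=
  uniq s && sorted e s.

Definition closed_nbhd (V : finType) (e : rel V) (S : {set V}) : {set V} :=
  [set v | (v \in S) || [exists u in S, e u v]].

(** Factor 3 for closed neighbourhoods is factor 2 for outer ones, exactly what the set of ends
    reached by rotations fails to have. *)
Definition expander (V : finType) (e : rel V) : Prop :=
  forall S : {set V}, 4 * #|S| <= #|V| -> 3 * #|S| <= #|closed_nbhd e S|.

Definition consec (V : Type) (s : seq V) : seq (V * V) := zip s (behead s).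

Lemma consec_rcons2 (V : Type) (s : seq V) (u w : V) :
  consec (rcons (rcons s u) w) = rcons (consec (rcons s u)) (u, w).
Proof.
rewrite /consec; elim: s => [|x [|y s] IH] //=.
by move: IH => /= ->.
Qed.

Lemma consec_cat (V : Type) (s t : seq V) (w : V) :
  consec (s ++ w :: t) = consec (rcons s w) ++ consec (w :: t).
Proof.
rewrite /consec; elim: s => [|x [|y s] IH] //=.
by move: IH => /= ->.
Qed.

Lemma mem_consec_rev (V : eqType) (s : seq V) (a b : V) :
  ((a, b) \in consec (rev s)) = ((b, a) \in consec s).
Proof.
elim: s => [|x [|y s] IH] //.
rewrite rev_cons {1}rev_cons consec_rcons2 -rev_cons mem_rcons in_cons IH.
by rewrite /consec /= in_cons !xpair_eqE andbC.
Qed.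

Lemma mem_consec_nth (V : eqType) (x0 : V) (s : seq V) (i : nat) :
  i.+1 < size s -> (nth x0 s i, nth x0 s i.+1) \in consec s.
Proof.
elim: s i => [|x [|y s] IH] [|i] //=.
  by rewrite /consec /= in_cons eqxx.
by rewrite ltnS => hi; rewrite /consec /= in_cons IH ?orbT.
Qed.

Lemma mem_consecP (V : eqType) (x0 : V) (s : seq V) (a b : V) :
  (a, b) \in consec s ->
  exists i, [/\ i.+1 < size s, nth x0 s i = a & nth x0 s i.+1 = b].
Proof.
elim: s => [|x [|y s] IH] //.
rewrite /consec /= in_cons => /orP[/eqP[-> ->]|/IH[i [h1 h2 h3]]].
  by exists 0.
by exists i.+1.
Qed.

Lemma consec_pred (V : eqType) (t1 t2 : seq V) (x0 w a : V) :
  uniq (t1 ++ w :: t2) -> (a, w) \in consec (t1 ++ w :: t2) ->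
  t1 <> [::] /\ a = last x0 t1.
Proof.
move=> U /(mem_consecP x0)[i [hi ha hw]].
have wE : nth x0 (t1 ++ w :: t2) (size t1) = w by rewrite nth_cat ltnn subnn.
have iE : i.+1 = size t1.
  apply/eqP; rewrite -(nth_uniq x0 hi _ U) ?hw ?wE //.
  by rewrite size_cat /= -addSnnS leq_addr.
split; first by case: (t1) iE.
by rewrite -ha nth_cat -iE ltnSn -nth_last -iE.
Qed.

Lemma consec_succ (V : eqType) (t1 t2 : seq V) (x0 w b : V) :
  uniq (t1 ++ w :: t2) -> (w, b) \in consec (t1 ++ w :: t2) ->
  t2 <> [::] /\ b = head x0 t2.
Proof.
move=> U /(mem_consecP x0)[i [hi hw hb]].
have wE : nth x0 (t1 ++ w :: t2) (size t1) = w by rewrite nth_cat ltnn subnn.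
have iE : i = size t1.
  apply/eqP; rewrite -(nth_uniq x0 (ltnW hi) _ U) ?hw ?wE //.
  by rewrite size_cat /= -addSnnS leq_addr.
split.
  by move=> t20; move: hi; rewrite t20 iE size_cat /= addn1 ltnn.
by rewrite -hb nth_cat iE ltnNge leqnSn /= subSnn /= nth0.
Qed.

Section Rot.
Variables (V : finType) (e : rel V).
Hypothesis eC : symmetric e.

(* The moving end of the path is its head; the last vertex stays fixed. *)
Inductive rotations (P : seq V) : seq V -> Prop :=
| Rot0 : rotations P P
| RotS v s1 w s2 : rotations P ((v :: s1) ++ w :: s2) -> e v w ->
    rotations P (rev (v :: s1) ++ w :: s2).

Lemma rotation_path v s1 w s2 :
  is_path e ((v :: s1) ++ w :: s2) -> e v w ->
  is_path e (rev (v :: s1) ++ w :: s2).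
Proof.
move=> /andP[U S] evw; apply/andP; split.
  have -> : uniq (rev (v :: s1) ++ w :: s2) = uniq ((v :: s1) ++ w :: s2) => //.
  by apply: perm_uniq; rewrite perm_cat2r perm_rev.
move: S; rewrite /= cat_path /= => /and3P[p1 _ p2].
have pr : sorted e (rev (v :: s1)).
  rewrite rev_sorted /=; rewrite (eq_path (e' := e)) // => a b; exact: eC.
move: pr; rewrite rev_cons; case: (rev s1) => [|a r] /=.
  by rewrite evw p2.
move=> pa; rewrite cat_path pa last_rcons /= evw p2 //.
Qed.

Lemma rotations_inv P s : is_path e P -> rotations P s ->
  [/\ is_path e s, perm_eq s P & forall x0, last x0 s = last x0 P].
Proof.
move=> hP; elim=> [|v s1 w s2 _ [ih1 ih2 ih3] evw]; first by split.
split; first exact: rotation_path.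
  by rewrite (perm_trans _ ih2) // perm_cat2r perm_rev.
by move=> x0; rewrite -ih3 !last_cat.
Qed.

Definition rot_heads (P : seq V) (v : V) : Prop :=
  exists s, rotations P (v :: s).

(* An edge broken by a rotation has one of its ends at the head of the new path. *)
Lemma rot_heads_consec P s a b : is_path e P -> rotations P s ->
  ~ rot_heads P a -> ~ rot_heads P b ->
  ((a, b) \in consec P) || ((b, a) \in consec P) ->
  ((a, b) \in consec s) || ((b, a) \in consec s).
Proof.
move=> hP rs na nb hab; elim: rs => [//|v s1 w s2 rs IH evw].
have rs' := RotS rs evw.
have [u [r ru]] : exists u r, rev (v :: s1) = u :: r.
  by rewrite rev_cons; case: (rev s1) => [|u r] /=; [exists v, [::] | exists u, (rcons r v)].
have hu : rot_heads P u by exists (r ++ w :: s2); rewrite -cat_cons -ru.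
have uE : v :: s1 = rcons (rev r) u by rewrite -rev_cons -ru revK.
move: IH; rewrite !consec_cat !mem_cat uE consec_rcons2 !mem_rcons !in_cons !xpair_eqE.
have -> : (a == u) = false by apply/eqP => au; apply: na; rewrite au.
have -> : (b == u) = false by apply/eqP => au; apply: nb; rewrite au.
rewrite /= -uE => IH.
have X : ((a, b) \in consec (rev (v::s1))) || ((b, a) \in consec (rev (v::s1))) ->
   ((a, b) \in consec (rcons (rev (v :: s1)) w)) || ((b, a) \in consec (rcons (rev (v :: s1)) w)).
  rewrite rev_cons consec_rcons2 !mem_rcons !in_cons.
  by case/orP => ->; rewrite ?orbT.
move: X; rewrite !mem_consec_rev => X.
case/orP: IH => /orP[h|h].
- by have := X; rewrite h ?orbT => /(_ isT)/orP[]->; rewrite ?orbT.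
- by rewrite h orbT.
- by have := X; rewrite h ?orbT => /(_ isT)/orP[]->; rewrite ?orbT.
- by rewrite h !orbT.
Qed.

(** Posa's lemma. Maximality puts [w] on the rotated path [s], and its predecessor [u] there becomes
    a head by rotating at [w]. If neither [w] nor a neighbour of [w] on [P] is ever a head, the
    edges of [P] at [w] survive in [s]; none of them leads to the head [u], so they would all have
    to lead to the single successor of [w]. *)
Lemma rot_heads_nbhd P (x0 : V) : is_path e P ->
  (forall s, is_path e s -> size s <= size P) ->
  forall v w, rot_heads P v -> e v w ->
  rot_heads P w \/ (exists i, i.+1 < size P /\
     (nth x0 P i = w /\ rot_heads P (nth x0 P i.+1) \/
      nth x0 P i.+1 = w /\ rot_heads P (nth x0 P i))).
Proof.
move=> hP hmax v w [s rs] evw.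
have [wv|wv] := eqVneq w v; first by left; rewrite wv; exists s.
have [hs ps ls] := rotations_inv hP rs.
have ws : w \in v :: s.
  apply/negPn/negP => nw.
  have : is_path e (w :: v :: s).
    move: hs nw; rewrite /is_path /= => /andP[/andP[-> ->] ->].
    by rewrite in_cons negb_or eC evw => /andP[-> ->].
  by move/hmax => /=; rewrite -(perm_size ps) /= ltnn.
have wP : w \in P by rewrite -(perm_mem ps).
move: (ws); rewrite in_cons (negbTE wv) /= => /path.splitPr def_s.
case: {-2}s / def_s (erefl s) => s1 s2 sE.
rewrite -sE -cat_cons in rs hs ps ls.
have rs' := RotS rs evw.
have [u [r ru]] : exists u r, rev (v :: s1) = u :: r.
  by rewrite rev_cons; case: (rev s1) => [|u r] /=; [exists v, [::] | exists u, (rcons r v)].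
have hu : rot_heads P u by exists (r ++ w :: s2); rewrite -cat_cons -ru.
have uE : last x0 (v :: s1) = u by rewrite -[v :: s1]revK ru rev_cons last_rcons.
have /andP[Us _] := hs.
have /andP[UP _] := hP.
have iP : index w P < size P by rewrite index_mem.
have nthw : nth x0 P (index w P) = w by rewrite nth_index.
case: (EM (rot_heads P w)) => [|nw]; first by left.
right; move: iP nthw; case: (index w P) => [|k] kP nthw.
  (* Index 0: [w] is the head of [P], hence itself in [rot_heads P]. *)
  case: nw; case: (P) kP nthw (Rot0 P) => [//|z P'] /= _ -> h.
  by exists P'.
have aw := mem_consec_nth x0 kP; rewrite nthw in aw.
case: (EM (rot_heads P (nth x0 P k))) => [ha|na]; first by exists k; split => //; right.
have := rot_heads_consec hP rs na nw; rewrite aw => /(_ isT)/orP[].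
  by move/(consec_pred x0 Us) => [_]; rewrite uE => au; case: na; rewrite au.
move/(consec_succ x0 Us) => [s20 aE].
have [k2|k2] := ltnP k.+2 (size P).
  have wb := mem_consec_nth x0 k2; rewrite nthw in wb.
  case: (EM (rot_heads P (nth x0 P k.+2))) => [hb|nb]; first by exists k.+1; split => //; left.
  have := rot_heads_consec hP rs nw nb; rewrite wb => /(_ isT)/orP[].
    move/(consec_succ x0 Us) => [_]; rewrite -aE => /eqP.
    by rewrite nth_uniq // ?(ltnW kP) // => /eqP/esym/eqP; rewrite ltn_eqF.
  by move/(consec_pred x0 Us) => [_]; rewrite uE => au; case: nb; rewrite au.
(* Here [w] ends [P]. Rotations keep the last vertex, so [w] also ends [s], although it has the
   successor found above. *)
have wl : last x0 P = w.
  by rewrite -nth_last; have -> : (size P).-1 = k.+1 by apply/eqP; rewrite eqn_leq; case: (size P) kP k2 => //= z; rewrite !ltnS => -> ->.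
have := ls x0; rewrite wl last_cat /= => lw.
move: Us; rewrite cat_uniq => /and3P[_ _] /= /andP[/negP[]].
by case: (s2) s20 lw => //= z t _ <-; rewrite mem_last.
Qed.

Definition rot_set (P : seq V) : {set V} := [set v | `[< rot_heads P v >]].

(** Every neighbour of a reachable end is an end or sits next to one on [P], at most two places per
    end. The head of [P] is an end without predecessor, which makes the inequality strict. *)
Lemma card_rot_nbhd P : P <> [::] -> is_path e P ->
  (forall s, is_path e s -> size s <= size P) ->
  #|closed_nbhd e (rot_set P)| < 3 * #|rot_set P|.
Proof.
case: P => [//|h P'] _; set P := h :: P' => hP hmax.
have hh : h \in rot_set P by rewrite inE; apply/asboolP; exists P'; exact: Rot0.
have /andP[UP _] := hP.
pose succ v := nth h P (index v P).+1; pose pred v := nth h P (index v P).-1.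
have sub : closed_nbhd e (rot_set P) \subset
    rot_set P :|: (succ @: rot_set P :|: pred @: (rot_set P :\ h)).
  apply/subsetP => w; rewrite inE => /orP[wR|/exists_inP[v vR evw]]; first by rewrite inE wR.
  move: vR; rewrite inE => /asboolP vR.
  have [wR|[i [iP [[iw R]|[iw R]]]]] := rot_heads_nbhd h hP hmax vR evw.
  - by rewrite inE; apply/orP; left; rewrite inE; apply/asboolP.
  - rewrite !inE; apply/orP; right; apply/orP; right.
    apply/imsetP; exists (nth h P i.+1).
      rewrite !inE; apply/andP; split; last by apply/asboolP.
      by rewrite -[h]/(nth h P 0) nth_uniq.
    by rewrite /pred index_uniq.
  - rewrite !inE; apply/orP; right; apply/orP; left.
    apply/imsetP; exists (nth h P i); first by rewrite !inE; apply/asboolP.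
    by rewrite /succ index_uniq // ltnW.
have := subset_leq_card sub => /leq_ltn_trans; apply.
have c1 := leq_imset_card succ (mem (rot_set P)).
have c2 := leq_imset_card pred (mem (rot_set P :\ h)).
have c3 := cardsD1 h (rot_set P); rewrite hh in c3.
apply: leq_ltn_trans (leq_card_setU _ _) _.
apply: (@leq_ltn_trans (#|rot_set P| + (#|rot_set P| + #|rot_set P :\ h|))).
  rewrite leq_add2l; apply: leq_trans (leq_card_setU _ _) _.
  exact: leq_add.
by rewrite mulSn ltn_add2l mul2n -addnn ltn_add2l c3 add1n.
Qed.

End Rot.

Definition longest_path (V : finType) (e : rel V) (P : seq V) : Prop :=
  is_path e P /\ forall s, is_path e s -> size s <= size P.

Lemma exists_longest_path (V : finType) (e : rel V) : exists P, longest_path e P.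
Proof.
have hb s : is_path e s -> size s <= #|V|.
  by case/andP => U _; rewrite -(card_uniqP U) max_card.
pose Q k := `[< exists2 s, is_path e s & size s = k >].
have ex : exists k, Q k by exists 0; apply/asboolP; exists [::].
have ub k : Q k -> k <= #|V| by move=> /asboolP[s /hb h <-].
case: (ex_maxnP ex ub) => k /asboolP[P hP <-] hmax.
by exists P; split => // s hs; apply: hmax; apply/asboolP; exists s.
Qed.

Lemma is_path_rev (V : finType) (e : rel V) s :
  symmetric e -> is_path e (rev s) = is_path e s.
Proof.
move=> eC; rewrite /is_path rev_uniq rev_sorted; congr (_ && _).
by case: s => //= x s; apply: eq_path => a b; exact: eC.
Qed.

Lemma rot_set_large (V : finType) (e : rel V) P :
  symmetric e -> expander e -> P <> [::] -> longest_path e P -> #|V| < 4 * #|rot_set e P|.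
Proof.
move=> eC exp P0 [hP hmax]; rewrite ltnNge; apply/negP => /exp.
by rewrite leqNgt card_rot_nbhd.
Qed.

Lemma longest_path_size (V : finType) (e : rel V) P s :
  longest_path e P -> is_path e s -> size s = size P -> longest_path e s.
Proof. by move=> [_ hmax] hs ss; split=> // t; rewrite ss; exact: hmax. Qed.

(** Adding such a pair closes a longest path into a cycle. The last vertex stands first because it
    is the one that rotations keep. *)
Definition boosters (V : finType) (e : rel V) : {set V * V} :=
  [set vw | `[< exists s, longest_path e s /\ exists t, s = vw.2 :: t /\ last vw.2 t = vw.1 >]].

(** Rotations produce more than a quarter of the vertices as heads [v]; reversing the path makes [v]
    the fixed end, and a second family of rotations gives more than a quarter as partners [w]. *)
Lemma card_boosters (V : finType) (e : rel V) :
  symmetric e -> expander e -> 0 < #|V| -> #|V| ^ 2 <= 16 * #|boosters e|.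
Proof.
move=> eC exp V0; have [P lP] := exists_longest_path e.
have /card_gt0P[x0 _] := V0.
have P0 : P <> [::].
  by move=> P0; have := lP.2 [:: x0] isT; rewrite P0.
have key v : v \in rot_set e P -> exists Rv : {set V},
    #|V| < 4 * #|Rv| /\ forall w, w \in Rv -> (v, w) \in boosters e.
  rewrite inE => /asboolP[s rs].
  have [hs ps ls] := rotations_inv eC lP.1 rs.
  have lQ : longest_path e (rev (v :: s)).
    apply: longest_path_size lP _ _; first by rewrite is_path_rev.
    by rewrite size_rev (perm_size ps).
  exists (rot_set e (rev (v :: s))); split.
    apply: rot_set_large => //.
    by move=> h; have := congr1 size h; rewrite size_rev.
  move=> w; rewrite inE => /asboolP[t rt].
  have [ht pt lt] := rotations_inv eC lQ.1 rt.
  rewrite inE; apply/asboolP; exists (w :: t); split.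
    by apply: longest_path_size lQ ht _; rewrite (perm_size pt).
  exists t; split => //=.
  by have /= -> := lt w; rewrite rev_cons last_rcons.
have LR := rot_set_large eC exp P0 lP.
have c : \sum_(v in rot_set e P) #|[set w | (v, w) \in boosters e]| <= #|boosters e|.
  rewrite -[X in _ <= X]sum1_card.
  rewrite [X in _ <= X](eq_bigl (fun p => true && ((p.1, p.2) \in boosters e))); last by case.
  rewrite -(pair_big_dep xpredT (fun v w => (v, w) \in boosters e) (fun _ _ => 1)) /=.
  rewrite [X in _ <= X](bigID (mem (rot_set e P))) /=.
  apply: leq_trans (leq_addr _ _); apply: leq_sum => v _.
  by rewrite -sum1_card; apply: eq_leq; apply: eq_bigl => w; rewrite inE.
have c2 : #|rot_set e P| * #|V| <= 4 * #|boosters e|.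
  apply: leq_trans (leq_mul (leqnn 4) c); rewrite big_distrr /= -sum_nat_const.
  apply: leq_sum => v /key[Rv [h1 h2]]; apply: leq_trans (ltnW h1) _.
  by rewrite leq_mul2l /=; apply/subset_leq_card/subsetP => w /h2; rewrite inE.
rewrite -[16]/(4 * 4) -mulnA; apply: leq_trans (leq_mul (leqnn 4) c2).
by rewrite mulnA -mulnn leq_mul2r (ltnW LR) orbT.
Qed.

Lemma expander_connected (V : finType) (e : rel V) (C : {set V}) :
  symmetric e -> expander e -> 12 <= #|V| -> C != set0 -> C != setT ->
  exists c y, [/\ c \in C, y \notin C & e c y].
Proof.
move=> eC exp V12 C0 CT.
case: (boolP [exists c in C, [exists y in ~: C, e c y]]) => [/exists_inP[c cC /exists_inP[y yC ecy]]|].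
  by exists c, y; split => //; move: yC; rewrite inE.
rewrite negb_exists_in => /forall_inP noE.
suff no (D : {set V}) : D != set0 -> 2 * #|D| <= #|V| ->
    (forall u v, u \in D -> e u v -> v \in D) -> False.
  have cc := cardsC C.
  have [h|h] := leqP (2 * #|C|) #|V|; exfalso.
    apply: (no C) => // u v uC euv; apply/negPn/negP => vC.
    by have /negP[] := noE _ uC; apply/exists_inP; exists v => //; rewrite inE.
  apply: (no (~: C)).
  - by apply: contra CT => /eqP h0; rewrite -[C]setCK h0 setC0.
  - by rewrite -(leq_add2l (2 * #|C|)) -mulnDr cc mul2n -addnn leq_add2r ltnW.
  move=> u v; rewrite !inE => uC euv; apply/negP => vC.
  by have /negP[] := noE _ vC; apply/exists_inP; exists u; rewrite ?inE // eC.
move=> D0 hD cl.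
have sub (S : {set V}) : S \subset D -> closed_nbhd e S \subset D.
  move=> /subsetP SD; apply/subsetP => v; rewrite inE => /orP[/SD//|/exists_inP[u /SD uD euv]].
  exact: cl euv.
have [h|h] := leqP (4 * #|D|) #|V|.
  have := exp _ h; have := subset_leq_card (sub _ (subxx D)).
  move=> h1 h2; have := leq_trans h2 h1.
  by rewrite -card_gt0 in D0; lia.
(* If [D] exceeds a quarter, a subset of size [#|V| %/ 4] already expands to more than half of the
   vertices, while its neighbourhood stays in [D]; 12 vertices suffice for this rounding. *)
have /card_geqP[s [us ss sD]] : #|V| %/ 4 <= #|D|.
  lia.
have SE : #|[set x in s]| = #|V| %/ 4 by rewrite cardsE (card_uniqP us).
have : 4 * #|[set x in s]| <= #|V| by rewrite SE; lia.
move/exp; have /sub/subset_leq_card : [set x in s] \subset D.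
  by apply/subsetP => x; rewrite inE => /sD.
rewrite SE => h1 h2; have := leq_trans h2 h1; lia.
Qed.

(** The new pair turns a longest path into a cycle. If it is not spanning, connectivity gives an
    edge leaving it, and opening the cycle at that edge yields a path with one more vertex. *)
Lemma booster_improves (V : finType) (e e' : rel V) (v w : V) P :
  symmetric e -> expander e -> 12 <= #|V| ->
  symmetric e' -> subrel e e' -> (v, w) \in boosters e -> e' v w ->
  longest_path e P ->
  has_hamilton_cycle e' \/ exists2 s, is_path e' s & size P < size s.
Proof.
move=> eC exp V12 e'C ee'; rewrite inE => /asboolP[s [ls [t /= [sE lt]]]] e'vw lP.
have sP : size s = size P.
  by apply/eqP; rewrite eqn_leq lP.2 ?ls.2 //; [case: lP | case: ls].
have [/andP[us ps] _] := ls.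
have cs : cycle e' s.
  by rewrite sE /= rcons_path lt e'vw andbT; move: ps; rewrite sE /=; exact: sub_path.
have [sV|sV] := eqVneq (size s) #|V|.
  left; rewrite /has_hamilton_cycle (leq_trans _ V12) //=.
  apply/existsP; exists (Tuple (introT eqP sV)).
  by rewrite /ucycleb /= cs us.
right; have [||c [y [cC yC ecy]]] := expander_connected (C := [set x in s]) eC exp V12.
- by apply/set0Pn; exists w; rewrite inE sE mem_head.
- apply: contra sV => /eqP h; rewrite -(card_uniqP us) -cardsT -h cardsE //.
move: cC yC; rewrite !inE => cs' ys.
have [i s' rs] := rot_to cs'.
exists (y :: c :: s'); last by rewrite -sP -(size_rot i s) rs.
have ss' : c :: s' =i s by move=> x; rewrite -rs mem_rot.
apply/andP; split.
  by rewrite cons_uniq ss' ys /= -[_ && _]/(uniq (c :: s')) -rs rot_uniq.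
rewrite /= e'C ee' //=.
by move: cs; rewrite -(rot_cycle i) rs /= rcons_path => /andP[].
Qed.

Import Order.TTheory GRing.Theory Num.Theory.
Local Open Scope ring_scope.

(** * Adding random blocks to an expander *)

Definition avg (R : realFieldType) (T : finType) (g : T -> R) : R :=
  (\sum_y g y) / #|T|%:R.

(** Expectation over [k] independent uniform samples, recursive so that the samples can be exposed
    one by one. *)
Fixpoint avgl (R : realFieldType) (T : finType) (k : nat) (g : seq T -> R) : R :=
  if k is k'.+1 then avg (fun y => avgl k' (fun l => g (y :: l))) else g [::].

Section Averages.
Variables (R : realFieldType) (T : finType).
Implicit Types (f g : T -> R) (k : nat).

Lemma avg_le f g : (forall y, f y <= g y) -> avg f <= avg g.
Proof.
by move=> fg; rewrite /avg ler_wpM2r ?invr_ge0 ?ler0n // ler_sum.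
Qed.

Lemma eq_avg f g : f =1 g -> avg f = avg g.
Proof. by move=> fg; congr (_ / _); apply: eq_bigr => y _. Qed.

Lemma avg_ge0 f : (forall y, 0 <= f y) -> 0 <= avg f.
Proof. by move=> h; rewrite /avg mulr_ge0 ?invr_ge0 ?ler0n ?sumr_ge0. Qed.

Lemma avg_cst (c : R) : (0 < #|T|)%N -> avg (fun _ : T => c) = c.
Proof.
move=> T0; rewrite /avg sumr_const -[c *+ _]mulr_natr mulfK //.
by rewrite pnatr_eq0 -lt0n.
Qed.

Lemma avgZ (c : R) f : avg (fun y => c * f y) = c * avg f.
Proof. by rewrite /avg -mulr_sumr mulrA. Qed.

Lemma avgD f g : avg (fun y => f y + g y) = avg f + avg g.
Proof. by rewrite /avg big_split mulrDl. Qed.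

Lemma avg_sum (I : Type) (r : seq I) (P : pred I) (F : I -> T -> R) :
  avg (fun y => \sum_(i <- r | P i) F i y) = \sum_(i <- r | P i) avg (F i).
Proof. by rewrite /avg exchange_big /= mulr_suml. Qed.

Lemma avgl_le k (f g : seq T -> R) : (forall l, size l = k -> f l <= g l) ->
  avgl k f <= avgl k g.
Proof.
elim: k f g => [|k IH] f g fg /=; first exact: fg.
by apply: avg_le => y; apply: IH => l sl; apply: fg; rewrite /= sl.
Qed.

Lemma eq_avgl k (f g : seq T -> R) : (forall l, size l = k -> f l = g l) ->
  avgl k f = avgl k g.
Proof.
by move=> fg; apply/eqP; rewrite eq_le !avgl_le // => l /fg ->.
Qed.

Lemma avgl_cst k (c : R) : (0 < #|T|)%N -> avgl k (fun _ : seq T => c) = c.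
Proof. by move=> T0; elim: k => [//|k IH] /=; rewrite IH avg_cst. Qed.

Lemma avglZ k (c : R) (f : seq T -> R) : avgl k (fun l => c * f l) = c * avgl k f.
Proof.
elim: k f => [//|k IH] f /=; rewrite -avgZ; apply: eq_avg => y.
exact: IH.
Qed.

Lemma avglD k (f g : seq T -> R) : avgl k (fun l => f l + g l) = avgl k f + avgl k g.
Proof.
elim: k f g => [//|k IH] f g /=; rewrite -avgD; apply: eq_avg => y.
exact: IH.
Qed.

Lemma avgl_sum (I : Type) (r : seq I) (P : pred I) k (F : I -> seq T -> R) :
  avgl k (fun y => \sum_(i <- r | P i) F i y) = \sum_(i <- r | P i) avgl k (F i).
Proof.
elim: k F => [//|k IH] F /=; rewrite -avg_sum; apply: eq_avg => y.
exact: IH.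
Qed.

Lemma avgl_cat k1 k2 (f : seq T -> R) :
  avgl (k1 + k2) f = avgl k1 (fun l1 => avgl k2 (fun l2 => f (l1 ++ l2))).
Proof.
elim: k1 f => [//|k IH] f /=; apply: eq_avg => y.
exact: IH.
Qed.

Lemma avgl_prod (B : Type) (bl : seq B) (F : B -> T -> R) :
  avgl (size bl) (fun l => \prod_(x <- zip bl l) F x.1 x.2) =
  \prod_(b <- bl) avg (F b).
Proof.
elim: bl => [|b bl IH] /=; first by rewrite !big_nil.
rewrite big_cons -IH mulrC -avgZ; apply: eq_avg => y.
rewrite mulrC -avglZ; apply: eq_avgl => l _.
by rewrite big_cons.
Qed.

Lemma avgl_map_perm (B : Type) (bl : seq B) (h : B -> T -> T) (f : seq T -> R) :
  (forall b, injective (h b)) ->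
  avgl (size bl) (fun l => f [seq h x.1 x.2 | x <- zip bl l]) = avgl (size bl) f.
Proof.
move=> hI; elim: bl f => [//|b bl IH] f /=.
rewrite [LHS](eq_avg (g := fun y => avgl (size bl) (fun l => f (h b y :: l)))).
  by rewrite /avg [in RHS](reindex_inj (hI b)).
by move=> y; rewrite -(IH (fun l => f (h b y :: l))).
Qed.

End Averages.

Definition block_graph (V : eqType) (cs : seq (seq V)) : rel V :=
  fun u v => (u != v) && has (fun c => (u \in c) && (v \in c)) cs.

(* The flag tells triples from pairs; the third coordinate of a pair is a dummy. *)
Definition block (V : Type) (b : bool) (y : V * V * V) : seq V :=
  if b then [:: y.1.1; y.1.2; y.2] else [:: y.1.1; y.1.2].

Definition blocks (V : Type) (bl : seq bool) (l : seq (V * V * V)) : seq (seq V) :=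
  [seq block x.1 x.2 | x <- zip bl l].

Lemma block_graph_sym (V : eqType) (cs : seq (seq V)) : symmetric (block_graph cs).
Proof.
move=> u v; rewrite /block_graph eq_sym; congr (_ && _).
by apply: eq_has => c; rewrite andbC.
Qed.

Lemma block_graph_sub (V : eqType) (cs cs' : seq (seq V)) :
  {subset cs <= cs'} -> subrel (block_graph cs) (block_graph cs').
Proof.
move=> sub u v /andP[uv /hasP[c /sub cs'c h]].
by rewrite /block_graph uv; apply/hasP; exists c.
Qed.

Lemma has_hamilton_cycle_sub (V : finType) (e e' : rel V) :
  subrel e e' -> has_hamilton_cycle e -> has_hamilton_cycle e'.
Proof.
move=> ee' /andP[h /existsP[s /andP[cs us]]]; rewrite /has_hamilton_cycle h /=.
by apply/existsP; exists s; rewrite /ucycleb us andbT (sub_cycle ee').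
Qed.

(** Equal ends would mean a longest path with one vertex, but connectivity provides an edge. *)
Lemma boosters_neq (V : finType) (e : rel V) (v w : V) :
  symmetric e -> expander e -> (12 <= #|V|)%N -> (v, w) \in boosters e -> v != w.
Proof.
move=> eC exp V12; rewrite inE => /asboolP[s [[/andP[us _] hmax] [t [/= sE lt]]]].
apply/eqP => vw; move: us; rewrite sE /= -{1}vw -lt => /andP[wt _].
have t0 : t = [::] by case: (t) wt => // a t'; rewrite /= mem_last.
have [||c [y [cC yC ecy]]] := expander_connected (C := [set w]) eC exp V12.
- by apply/set0Pn; exists w; rewrite inE.
- by apply/eqP => /(congr1 (fun C : {set V} => #|C|)); rewrite cards1 cardsT; lia.
have := hmax [:: c; y]; rewrite sE t0 => /= h.
suff : is_path e [:: c; y] by move/h.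
rewrite /is_path /= ecy !andbT inE; apply: contraNneq yC => <- //.
Qed.

(* Each block halves 2 ^- (length of a longest path) with probability at least 1 / 16,
   as long as the graph is not Hamiltonian. *)
Lemma sprinkling (R : realFieldType) (V : finType) (bl : seq bool)
    (cs : seq (seq V)) (P : seq V) :
  (12 <= #|V|)%N -> expander (block_graph cs) -> longest_path (block_graph cs) P ->
  avgl (size bl) (fun l => (~~ has_hamilton_cycle (block_graph (cs ++ blocks bl l)))%:R)
   <= 2 ^+ (#|V|.+1 - size P) * (31 / 32) ^+ size bl :> R.
Proof.
move=> V12; elim: bl cs P => [|b bl IH] cs P exp lP.
  rewrite /= expr0 mulr1; apply: (@le_trans _ _ 1); first by case: has_hamilton_cycle.
  by rewrite exprn_ege1 // ler1n.
rewrite [size (b :: bl)]/= [avgl _.+1 _]/=.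
set e := block_graph cs; have eC : symmetric e := block_graph_sym cs.
pose X : R := 2 ^+ (#|V|.+1 - size P) * (31 / 32) ^+ size bl.
have X0 : 0 <= X by rewrite mulr_ge0 ?exprn_ge0 // divr_ge0.
have mono y : subrel e (block_graph (rcons cs (block b y))).
  by apply: block_graph_sub => c hc; rewrite mem_rcons inE hc orbT.
have sP : (size P <= #|V|)%N.
  by case: lP => /andP[uP _] _; rewrite -(card_uniqP uP) max_card.
have key (y : V * V * V) :
    avgl (size bl) (fun l => (~~ has_hamilton_cycle (block_graph (cs ++ blocks (b :: bl) (y :: l))))%:R)
    <= X * (1 - 2^-1 * (y.1 \in boosters e)%:R).
  rewrite (eq_avgl (g := fun l => (~~ has_hamilton_cycle (block_graph (rcons cs (block b y) ++ blocks bl l)))%:R)); last first.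
    by move=> l _; rewrite cat_rcons.
  have exp' : expander (block_graph (rcons cs (block b y))).
    move=> S /exp h; apply: leq_trans h _; apply/subset_leq_card/subsetP => v.
    rewrite !inE => /orP[->//|/exists_inP[u uS euv]]; apply/orP; right.
    by apply/exists_inP; exists u => //; apply: mono.
  have [P' lP'] := exists_longest_path (block_graph (rcons cs (block b y))).
  have PP' : (size P <= size P')%N.
    apply: lP'.2; move: lP.1 => /andP[uP pP]; rewrite /is_path uP /=.
    by case: (P) pP => //= a s; apply: sub_path; apply: mono.
  have sP' : (size P' <= #|V|)%N.
    by case: lP' => /andP[uP _] _; rewrite -(card_uniqP uP) max_card.
  have := IH _ _ exp' lP' => h.
  have [yB|_] := boolP (y.1 \in boosters e); last first.
    rewrite mulr0 subr0 mulr1; apply: le_trans h _.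
    rewrite ler_wpM2r ?exprn_ge0 ?divr_ge0 //; apply: ler_weXn2l; rewrite ?ler1n //.
    by rewrite leq_sub2l.
  rewrite mulr1; case: y yB exp' lP' h PP' => [[v w] y3] /= vwB exp' lP' h PP'.
  have vw := boosters_neq eC exp V12 vwB.
  have e'vw : block_graph (rcons cs (block b (v, w, y3))) v w.
    rewrite /block_graph vw /= has_rcons; apply/orP; left.
    by rewrite /block; case: (b); rewrite !inE !eqxx /= ?orbT.
  have [ham|[s hs Ps]] := booster_improves eC exp V12 (block_graph_sym _) (mono _) vwB e'vw lP.
    apply: (@le_trans _ _ 0); last by apply: mulr_ge0 => //; lra.
    rewrite -[leRHS](avgl_cst (T := (V * V * V)%type) (size bl)); last first.
      by apply/card_gt0P; exists (v, w, y3).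
    apply: avgl_le => l _; rewrite (has_hamilton_cycle_sub _ ham) //.
    by apply: block_graph_sub => c hc; rewrite mem_cat hc.
  apply: le_trans h _.
  have := lP'.2 _ hs => Ps'.
  apply: (@le_trans _ _ (2 ^+ (#|V|.+1 - (size P).+1) * (31 / 32) ^+ size bl)).
    rewrite ler_wpM2r ?exprn_ge0 ?divr_ge0 //; apply: ler_weXn2l; rewrite ?ler1n //.
    by rewrite leq_sub2l // (leq_trans Ps).
  rewrite /X.
  have -> : (#|V|.+1 - size P = (#|V|.+1 - (size P).+1).+1)%N by lia.
  by rewrite exprS le_eqVlt; apply/orP; left; apply/eqP; field.
(* Only the first two coordinates of [y] are used. They form a booster with probability at least 1 /
   16, so the mean factor is at most [1 - 1 / 2 * 1 / 16 = 31 / 32]. *)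
apply: le_trans (avg_le key) _.
have V0 : 0 < #|V|%:R :> R by rewrite ltr0n; lia.
rewrite avgZ exprSr mulrA -/X ler_wpM2l //.
have VVV0 : (0 < #|{: V * V * V}|)%N by rewrite !card_prod !muln_gt0; lia.
have -> : avg (fun y : V * V * V => 1 - 2^-1 * (y.1 \in boosters e)%:R) =
    1 - 2^-1 * avg (fun y : V * V * V => (y.1 \in boosters e)%:R) :> R.
  rewrite (eq_avg (g := fun y : V * V * V => 1 + - 2^-1 * (y.1 \in boosters e)%:R)).
    by rewrite avgD avgZ avg_cst // mulNr.
  by move=> y; rewrite mulNr.
have -> : avg (fun y : V * V * V => (y.1 \in boosters e)%:R) =
    #|boosters e|%:R / #|V|%:R ^+ 2 :> R.
  rewrite /avg !card_prod !natrM.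
  rewrite -(pair_bigA _ (fun p v => (p \in boosters e)%:R)) /=.
  under eq_bigr do rewrite sumr_const -[_ *+ _]mulr_natr.
  rewrite -mulr_suml -natr_sum.
  have -> : (\sum_p (p \in boosters e) = #|boosters e|)%N.
    by rewrite -sum1_card [RHS]big_mkcond; apply: eq_bigr => p _; case: ifP.
  by field; rewrite lt0r_neq0.
have V20 : (0 < #|V|)%N by lia.
have := card_boosters eC exp V20; rewrite -(ler_nat R) natrX natrM => h.
have : 1 / 16 <= #|boosters e|%:R / #|V|%:R ^+ 2 :> R.
  by rewrite ler_pdivlMr ?exprn_gt0 //; lra.
lra.
Qed.

(** Exploration from [C0]: a crossing block already meets the explored set and thus adds at most its
    number of vertices in [A] minus one. Afterwards its part in [A] is explored, so it never crosses
    again and may be removed from the list. *)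
Lemma cover_growth (V : finType) (A : {set V}) (cs : seq (seq V)) (C0 : {set V}) :
  C0 != set0 -> C0 \subset A ->
  (forall C : {set V}, C0 \subset C -> C \proper A ->
     exists2 c, c \in cs & has (mem C) c && has (mem (A :\: C)) c) ->
  (#|A| <= #|C0| + \sum_(c <- cs) (count (mem A) c).-1)%N.
Proof.
have [k] := ubnP (size cs); elim: k => // k IH in cs C0 *.
rewrite ltnS => sk C00 C0A cross.
have [->|C0nA] := eqVneq C0 A; first exact: leq_addr.
have C0pA : C0 \proper A by rewrite properEneq C0nA.
have [c ccs /andP[h1 h2]] := cross C0 (subxx _) C0pA.
have pcs := perm_to_rem ccs.
rewrite (perm_big _ pcs) big_cons /=.
pose X := [set x in A | x \in c].
have cX : (#|X| <= count (mem A) c)%N.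
  rewrite -size_filter; apply: leq_trans (card_size _).
  by apply/subset_leq_card/subsetP => x; rewrite !inE mem_filter.
have X0 : (0 < #|C0 :&: X|)%N.
  have /hasP[x xc xC0] := h1; apply/card_gt0P; exists x.
  by rewrite !inE xc (subsetP C0A) // !andbT.
have cU := cardsUI C0 X.
have XA : X \subset A by apply/subsetP => x; rewrite inE => /andP[].
apply: leq_trans (IH (rem c cs) (C0 :|: X) _ _ _ _) _.
- by rewrite size_rem //; case: (cs) ccs sk => //=; lia.
- by apply: contraNneq C00 => h; rewrite -subset0 -h subsetUl.
- by rewrite subUset C0A.
- move=> C; rewrite subUset => /andP[C0C XC] CA.
  have [c' c'cs h] := cross C C0C CA.
  exists c' => //; move: c'cs; rewrite (perm_mem pcs) inE => /orP[/eqP c'c|//].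
  move: h; rewrite c'c => /andP[_ /hasP[x xc]].
  by move=> /setDP[xA]; rewrite (subsetP XC) // inE xA xc.
by rewrite addnA leq_add2r; lia.
Qed.

Definition leaves (V : finType) (S A : {set V}) (c : seq V) : bool :=
  has (mem S) c && has (mem (~: A)) c.

(** Take [S] minimal among the violating sets and [A] its closed neighbourhood. If no block crossed
    between [C] and [A :\: C], the parts of [S] in the two would have neighbourhoods inside their
    own part; by minimality both parts expand, and adding up contradicts [#|A| < 3 * #|S|]. So the
    blocks connect [A], and [cover_growth] applies. *)
Lemma nonexpander_witness (V : finType) (cs : seq (seq V)) :
  ~ expander (block_graph cs) ->
  exists S A : {set V}, [/\ S \subset A, S != set0, (4 * #|S| <= #|V|)%N,
    (#|A| < 3 * #|S|)%N &
    all (fun c => ~~ leaves S A c) cs &&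
    (#|A| <= 1 + \sum_(c <- cs) (count (mem A) c).-1)%N].
Proof.
set e := block_graph cs => nexp.
pose bad (S : {set V}) := (4 * #|S| <= #|V|)%N && (#|closed_nbhd e S| < 3 * #|S|)%N.
have [S0 S0b] : exists S, bad S.
  apply: contrapT => nb; apply: nexp => S h; rewrite leqNgt; apply/negP => h'.
  by apply: nb; exists S; rewrite /bad h.
case: (arg_minnP (P := bad) (fun S => #|S|) S0b) => S /andP[S4 Sb] Smin.
pose A := closed_nbhd e S.
have SA : S \subset A by apply/subsetP => v; rewrite inE => ->.
have Sn0 : S != set0.
  by apply: contraTneq Sb => ->; rewrite cards0 muln0.
have noleave : all (fun c => ~~ leaves S A c) cs.
  apply/allP => c ccs; apply/negP => /andP[/hasP[u uc uS] /hasP[v vc]].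
  move=> /setCP; apply; rewrite inE; have [->|vu] := eqVneq v u; first by apply/orP; left.
  apply/orP; right; apply/exists_inP; exists u => //=.
  by rewrite /e /block_graph eq_sym vu; apply/hasP; exists c => //; rewrite uc vc.
exists S, A; split => //; rewrite noleave /=.
have [x0 x0A] : exists x, x \in A.
  by case/set0Pn: Sn0 => x /(subsetP SA); exists x.
rewrite -(cards1 x0); apply: cover_growth.
- by apply/set0Pn; exists x0; rewrite inE.
- by rewrite sub1set.
move=> C x0C /andP[CA nAC]; apply: contrapT => nocross.
have sep c : c \in cs -> has (mem C) c -> has (mem (A :\: C)) c -> False.
  by move=> ccs h1 h2; apply: nocross; exists c => //; rewrite h1 h2.
have Nsub (D : {set V}) : D \subset A -> 
   (forall c, c \in cs -> has (mem D) c -> has (mem (A :\: D)) c -> False) ->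
   closed_nbhd e (S :&: D) \subset D.
  move=> DA sepD; apply/subsetP => v; rewrite inE => /orP[|/exists_inP[u]].
    by rewrite inE => /andP[].
  rewrite inE => /andP[uS uD] /= /andP[uv /hasP[c ccs /andP[uc vc]]].
  apply/negPn/negP => vD.
  have vA : v \in A.
    apply/negPn/negP => vA; move: (allP noleave _ ccs) => /negP[].
    by apply/andP; split; apply/hasP; [exists u | exists v] => //; rewrite /= inE.
  apply: (sepD c ccs); apply/hasP; [by exists u | exists v => //].
  by rewrite /= inE vD.
have N1 := Nsub C CA sep.
have N2 : closed_nbhd e (S :&: (A :\: C)) \subset A :\: C.
  apply: Nsub; first exact: subsetDl.
  move=> c ccs h1; rewrite setDDr setDv set0U => h2.
  apply: (sep c ccs) => //; apply: sub_has h2 => x /=; by rewrite inE => /andP[].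
have Ssplit : #|S| = (#|S :&: C| + #|S :&: (A :\: C)|)%N.
  rewrite setIDA (setIidPl SA); by rewrite cardsID.
have Asplit : #|A| = (#|C| + #|A :\: C|)%N.
  by rewrite -(cardsID C A) (setIidPr CA).
have c1 := subset_leq_card N1; have c2 := subset_leq_card N2.
have C0 : (0 < #|C|)%N by apply/card_gt0P; exists x0; rewrite -sub1set.
have AC0 : (0 < #|A :\: C|)%N by rewrite card_gt0 setD_eq0.
(* Minimality applies to [S :&: D] because it cannot be all of [S]: the neighbourhood [A] would then
   fit into the smaller set [D]. *)
have small (D : {set V}) : (#|D| < #|A|)%N ->
    closed_nbhd e (S :&: D) \subset D -> (3 * #|S :&: D| <= #|closed_nbhd e (S :&: D)|)%N.
  move=> DA ND; rewrite leqNgt; apply/negP => hlt.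
  have SD : (#|S :&: D| <= #|S|)%N by apply/subset_leq_card/subsetIl.
  have /Smin : bad (S :&: D).
    by rewrite /bad hlt andbT (leq_trans _ S4) // leq_mul2l SD.
  move=> SS; have SE : S :&: D = S by apply/eqP; rewrite eqEcard subsetIl.
  by have := subset_leq_card ND; rewrite SE leqNgt DA.
have := small C; have := small (A :\: C) => s2 s1.
have := s1 _ N1; have := s2 _ N2.
move: Sb; rewrite -/A; lia.
Qed.

(** * Expansion of the random block graph *)

(* Markov weight for the union bound: if no block joins S to the complement of A and
   A is connected by the blocks, the exponents add up to at least #|A| - 1. *)
Definition weight (R : realFieldType) (V : finType) (z : R) (S A : {set V})
    (b : bool) (y : V * V * V) : R :=
  (~~ leaves S A (block b y))%:R * z ^+ (count (mem A) (block b y)).-1.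

Definition density (R : realFieldType) (V : finType) (A : {set V}) : R :=
  #|A|%:R / #|V|%:R.

Lemma avg_indicator (R : realFieldType) (V : finType) (A : {set V}) :
  avg (fun v => (v \in A)%:R) = density R A.
Proof.
rewrite /avg /density; congr (_ / _); rewrite -natr_sum; congr (_%:R).
by rewrite -sum1_card [RHS]big_mkcond; apply: eq_bigr => p _; case: ifP.
Qed.

Lemma avg_triple (R : realFieldType) (V : finType) (f g h : V -> R) :
  avg (fun y : V * V * V => f y.1.1 * g y.1.2 * h y.2) = avg f * avg g * avg h.
Proof.
rewrite /avg !card_prod !natrM !invfM.
rewrite -(pair_bigA _ (fun p v => f p.1 * g p.2 * h v)) /=.
under eq_bigr do rewrite -mulr_sumr.
rewrite -mulr_suml -(pair_bigA _ (fun u v => f u * g v)) /=.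
under eq_bigr do rewrite -mulr_sumr.
by rewrite -mulr_suml; ring.
Qed.

(** A bound that is polynomial in the indicators, so that its mean factorises. For triples only the
    cyclically ordered pairs are subtracted: as [S] lies in [A], at most one of these can lead from
    [S] out of [A], which keeps the bound nonnegative. *)
Lemma weight_le (R : realFieldType) (V : finType) (z : R) (S A : {set V}) b
    (y : V * V * V) : 1 <= z -> S \subset A ->
  let s (v : V) := (v \in S)%:R : R in let a (v : V) := (v \in A)%:R : R in
  let: (u, v, w) := y in
  weight z S A b y <=
  if b then 1 - (s u * (1 - a v) + s v * (1 - a w) + s w * (1 - a u)) +
    ((z - 1) * (a u * a v + a v * a w + a w * a u) + (z ^+ 2 - 1) * (a u * a v * a w))
  else 1 - (s u * (1 - a v) + s v * (1 - a u)) + (z - 1) * (a u * a v).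
Proof.
move=> z1 /subsetP SA; case: y => [[u v] w] /=.
have z2 : 1 <= z ^+ 2 by rewrite exprn_ege1.
have hu := SA u; have hv := SA v; have hw := SA w.
rewrite /weight /leaves /block; case: b => /=; rewrite !inE.
  move: hu hv hw; case: (u \in S); case: (u \in A) => hu; try (by have := hu isT);
  case: (v \in S); case: (v \in A) => hv; try (by have := hv isT);
  case: (w \in S); case: (w \in A) => hw; try (by have := hw isT);
  by rewrite /= ?expr0 ?expr1 ?mul0r ?mul1r; lra.
move: hu hv; case: (u \in S); case: (u \in A) => hu; try (by have := hu isT);
case: (v \in S); case: (v \in A) => hv; try (by have := hv isT);
by rewrite /= ?expr0 ?expr1 ?mul0r ?mul1r; lra.
Qed.

(** The [z] part is generous for pairs; in return both kinds of block get terms proportional to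
    their slots, and later only the total slot number matters. *)
Lemma avg_weight_le (R : realFieldType) (V : finType) (z : R) (S A : {set V}) (b : bool) :
  (0 < #|V|)%N -> 1 <= z -> S \subset A ->
  avg (weight z S A b) <= 1 - (2 + b)%:R * (density R S * (1 - density R A)) +
    (2 + b)%:R * ((z - 1) * density R A ^+ 2 + (z ^+ 2 - 1) * density R A ^+ 3).
Proof.
move=> V0 z1 SA; set x := density R S; set y := density R A.
have z2 : 1 <= z ^+ 2 by rewrite exprn_ege1.
have y0 : 0 <= y by rewrite divr_ge0.
pose T f g h (t : V * V * V) : R := f t.1.1 * g t.1.2 * h t.2.
pose s (v : V) : R := (v \in S)%:R; pose a (v : V) : R := (v \in A)%:R.
pose o (v : V) : R := 1; pose na (v : V) : R := 1 + - 1 * a v.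
have sE : avg s = x by exact: avg_indicator.
have aE : avg a = y by exact: avg_indicator.
have oE : avg o = 1 by exact: avg_cst.
have naE : avg na = 1 - y by rewrite /na avgD avgZ aE avg_cst // mulN1r.
case: b.
  pose G (t : V * V * V) := T o o o t + (- 1 * T s na o t + (- 1 * T o s na t + (- 1 * T na o s t +
    ((z - 1) * T a a o t + ((z - 1) * T o a a t + ((z - 1) * T a o a t + (z ^+ 2 - 1) * T a a a t)))))).
  apply: (@le_trans _ _ (avg G)).
    apply: avg_le => -[[u v] w]; have := @weight_le _ _ z S A true (u, v, w) z1 SA.
    rewrite /= => h; apply: le_trans h _; rewrite /G /T /= /na /o -/(a u) -/(a v) -/(a w) -/(s u) -/(s v) -/(s w).
    by rewrite le_eqVlt; apply/orP; left; apply/eqP; ring.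
  rewrite /G !(avgD, avgZ) /T !avg_triple sE aE oE naE -[(2 + true)%N]/3%N.
  have : 0 <= (z ^+ 2 - 1) * y ^+ 3 by rewrite mulr_ge0 ?subr_ge0 // exprn_ge0.
  have -> : y * y * y = y ^+ 3 by ring.
  lra.
pose G (t : V * V * V) := T o o o t + (- 1 * T s na o t + (- 1 * T na s o t + ((z - 1) * T a a o t))).
apply: (@le_trans _ _ (avg G)).
  apply: avg_le => -[[u v] w]; have := @weight_le _ _ z S A false (u, v, w) z1 SA.
  rewrite /= => h; apply: le_trans h _; rewrite /G /T /= /na /o -/(a u) -/(a v) -/(s u) -/(s v).
  by rewrite le_eqVlt; apply/orP; left; apply/eqP; ring.
rewrite /G !(avgD, avgZ) /T !avg_triple sE aE oE naE -[(2 + false)%N]/2%N.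
have : 0 <= (z ^+ 2 - 1) * y ^+ 3 by rewrite mulr_ge0 ?subr_ge0 // exprn_ge0.
have : 0 <= (z - 1) * y ^+ 2 by rewrite mulr_ge0 ?subr_ge0 // exprn_ge0.
lra.
Qed.

Definition small_pair (V : finType) (S A : {set V}) : bool :=
  [&& S \subset A, S != set0, (4 * #|S| <= #|V|)%N & (#|A| < 3 * #|S|)%N].

Lemma nonexpander_prob (R : realFieldType) (V : finType) (bl : seq bool)
    (z : {set V} -> R) : (forall A, 1 <= z A) ->
  avgl (size bl) (fun l => (~~ `[< @expander V (block_graph (blocks bl l)) >])%:R) <=
  \sum_S \sum_(A | small_pair S A)
     (z A ^+ (#|A|).-1)^-1 * \prod_(b <- bl) avg (weight (z A) S A b).
Proof.
move=> z1.
pose f (S A : {set V}) (l : seq (V * V * V)) : R :=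
  (z A ^+ (#|A|).-1)^-1 * \prod_(t <- zip bl l) weight (z A) S A t.1 t.2.
have f0 S A l : 0 <= f S A l.
  have zA : 0 <= z A by apply: le_trans (z1 A).
  rewrite mulr_ge0 ?invr_ge0 ?exprn_ge0 // prodr_ge0 // => t _.
  by rewrite mulr_ge0 // exprn_ge0.
apply: (@le_trans _ _ (avgl (size bl) (fun l => \sum_S \sum_(A | small_pair S A) f S A l))).
  apply: avgl_le => l _; case: asboolP => [_|nexp] /=.
    by rewrite sumr_ge0 // => S _; rewrite sumr_ge0.
  have [S [A [SA S0 S4 AS /andP[nl cnt]]]] := nonexpander_witness nexp.
  have sp : small_pair S A by rewrite /small_pair SA S0 S4 AS.
  rewrite (bigD1 S) //= (bigD1 A) //= -addrA.
  have zA : 0 < z A by apply: lt_le_trans (z1 A).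
  apply: (@le_trans _ _ (f S A l)); last first.
    rewrite lerDl addr_ge0 ?sumr_ge0 // => S' _; exact: sumr_ge0.
  have -> : f S A l = (z A ^+ (#|A|).-1)^-1 * z A ^+ (\sum_(c <- blocks bl l) (count (mem A) c).-1).
    rewrite /f; congr (_ * _); rewrite -prodrXr /blocks big_map big_seq [RHS]big_seq.
    apply: eq_bigr => t tz; rewrite /weight.
    by rewrite (allP nl) ?mul1r //; apply: map_f.
  rewrite mulrC ler_pdivlMr ?exprn_gt0 // mul1r ler_weXn2l //.
  by move: cnt; rewrite add1n; lia.
rewrite avgl_sum; apply: ler_sum => S _; rewrite avgl_sum; apply: ler_sum => A _.
by rewrite /f avglZ avgl_prod.
Qed.

Lemma exprn_le_fact (R : realType) (k : nat) :
  k%:R ^+ k <= k`!%:R * expR k%:R :> R.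
Proof.
case: k => [|k]; first by rewrite expr0 fact0 mul1r expR0.
have fk : 0 < k.+1`!%:R :> R by rewrite ltr0n fact_gt0.
rewrite mulrC -ler_pdivrMr //; apply: le_trans (expR_ge1Dxn k _) => //.
by rewrite lerDr.
Qed.

Lemma bin_le_expr (R : realType) (n k : nat) : (0 < n)%N ->
  'C(n, k)%:R * (k%:R / n%:R) ^+ k <= expR k%:R :> R.
Proof.
move=> n0; have nR : 0 < n%:R :> R by rewrite ltr0n.
have fk : 0 < k`!%:R :> R by rewrite ltr0n fact_gt0.
rewrite -(ler_pM2l fk); apply: le_trans (exprn_le_fact R k).
rewrite expr_div_n mulrA mulrA -natrM mulnC bin_ffact ler_pdivrMr ?exprn_gt0 //.
rewrite mulrC ler_wpM2l ?exprn_ge0 // -natrX ler_nat.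
have : (n ^_ k <= n ^ k)%N.
  rewrite ffact_prod -[X in (_ <= _ ^ X)%N](card_ord k) -prod_nat_const.
  by apply: leq_prod => i _; apply: leq_subr.
by [].
Qed.

(* This [z] makes the total contribution of the blocks inside A of order exp(O(#|A|)). *)
Lemma pair_term_le (R : realType) (V : finType) (bl : seq bool) (S A : {set V}) (l : R) :
  let L := (\sum_(b <- bl) (2 + b))%N in
  let x := density R S in let y := density R A in let z := 1 + (y * l)^-1 in
  1 <= l -> L%:R <= 3 * #|V|%:R * l -> S \subset A -> (0 < #|A|)%N ->
  (z ^+ (#|A|).-1)^-1 * \prod_(b <- bl) avg (weight z S A b) <=
  (y * l) ^+ (#|A|).-1 * expR (12 * #|A|%:R) * expR (- (L%:R * (x * (1 - y)))).
Proof.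
move=> L x y z l1 Ll SA A0.
have V0 : (0 < #|V|)%N by apply: leq_trans A0 (max_card _).
have nR : 0 < #|V|%:R :> R by rewrite ltr0n.
have y0 : 0 < y by rewrite divr_gt0 ?ltr0n.
have y1 : y <= 1 by rewrite ler_pdivrMr // mul1r ler_nat max_card.
have l0 : 0 < l by apply: lt_le_trans l1.
have yl0 : 0 < y * l by rewrite mulr_gt0.
have z1 : 1 <= z by rewrite lerDl invr_ge0 ltW.
rewrite -mulrA; apply: ler_pM.
- by rewrite invr_ge0 exprn_ge0 // (le_trans _ z1).
- apply: prodr_ge0 => b _; apply: avg_ge0 => t; rewrite mulr_ge0 // exprn_ge0 //.
  by rewrite (le_trans _ z1).
- rewrite -exprVn lerXn2r ?nnegrE ?invr_ge0 ?(ltW yl0) ?(le_trans _ z1) //.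
  rewrite invf_ple ?posrE ?(lt_le_trans _ z1) //.
  by rewrite lerDr.
rewrite -expRD; set E := (z - 1) * y ^+ 2 + (z ^+ 2 - 1) * y ^+ 3.
apply: (@le_trans _ _ (\prod_(b <- bl) expR ((2 + b)%:R * (E - x * (1 - y))))).
  apply: ler_prod => b _; apply/andP; split.
    apply: avg_ge0 => t; rewrite mulr_ge0 // exprn_ge0 //.
    by rewrite (le_trans _ z1).
  apply: le_trans (avg_weight_le b V0 z1 SA) _.
  rewrite -/x -/y -/E; apply: le_trans _ (expR_ge1Dx _).
  by rewrite le_eqVlt; apply/orP; left; apply/eqP; ring.
rewrite -expR_sum -mulr_suml -natr_sum ler_expR -/L mulrBr lerD2r.
have LR : 0 <= L%:R :> R by [].
(* Together with [L <= 3 * n * l] this gives [L * E <= 12 * #|A|], the origin of the constant 12. *)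
have Ele : E <= 4 * y / l.
  have -> : E = y / l + (2 * y ^+ 2 / l + y / l * l^-1).
    by rewrite /E /z; field; rewrite !lt0r_neq0.
  have h1 : y ^+ 2 / l <= y / l.
    apply: ler_wpM2r; first by rewrite invr_ge0 ltW.
    by rewrite expr2 ler_piMl // ltW.
  have h2 : y / l * l^-1 <= y / l.
    by rewrite ler_piMr ?invf_le1 // divr_ge0 ?(ltW y0) ?(ltW l0).
  have := h1; lra.
apply: (le_trans (ler_wpM2l LR Ele)).
have h : 0 <= 4 * y / l by apply: divr_ge0; [apply: mulr_ge0 => //; exact: ltW | exact: ltW].
apply: (le_trans (ler_wpM2r h Ll)).
have -> : y = #|A|%:R / #|V|%:R by [].
by rewrite le_eqVlt; apply/orP; left; apply/eqP; field; rewrite !lt0r_neq0.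
Qed.

(** Choosing [A] first and [S] inside it costs only [2 ^+ a], whereas a separate binomial
    coefficient for [S] would be too much. *)
Lemma sum_small_pairs (R : realType) (V : finType) (g : nat -> nat -> R) :
  (forall s a, 0 <= g s a) ->
  \sum_(S : {set V}) \sum_(A | small_pair S A) g #|S| #|A| <=
  \sum_(s < #|V|.+1 | (0 < s)%N && (4 * s <= #|V|)%N) \sum_(a < 3 * s | (s <= a)%N)
     'C(#|V|, a)%:R * 2 ^+ a * g s a.
Proof.
move=> g0; set n := #|V|.
pose Q (s a : nat) := [&& (0 < s)%N, (4 * s <= n)%N, (a < 3 * s)%N & (s <= a)%N].
have an (A : {set V}) : (#|A| < n.+1)%N by rewrite ltnS max_card.
apply: (@le_trans _ _ (\sum_(a < n.+1) \sum_(s < n.+1 | Q s a) 'C(n, a)%:R * 2 ^+ a * g s a)).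
  rewrite (exchange_big_dep xpredT) //= (partition_big (fun A : {set V} => inord #|A| : 'I_n.+1) xpredT) //=.
  apply: ler_sum => a _.
  apply: (@le_trans _ _ (\sum_(A : {set V} | #|A| == a) \sum_(s < n.+1 | Q s a) 2 ^+ a * g s a)); last first.
    rewrite sumr_const -[_ *+ _]mulr_natl mulr_sumr.
    have -> : #|[pred A : {set V} | #|A| == a]| = 'C(n, a).
      by have := cards_draws [set: V] a; rewrite cardsT => <-; apply: eq_card => A; rewrite !inE subsetT.
    by apply: ler_sum => s _; rewrite mulrA.
  rewrite (eq_bigl (fun A : {set V} => #|A| == a)); last first.
    by move=> A; rewrite -val_eqE /= inordK.
  apply: ler_sum => A /eqP Aa.
  rewrite (partition_big (fun S : {set V} => inord #|S| : 'I_n.+1) (fun s : 'I_n.+1 => Q s a)) /=; last first.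
    move=> S /and4P[SA S0 S4 AS]; rewrite inordK // /Q -Aa S4 AS card_gt0 S0.
    exact: subset_leq_card.
  apply: ler_sum => s sQ.
  apply: (@le_trans _ _ (\sum_(S : {set V} | S \subset A) g s a)).
    rewrite [leRHS](bigID (fun S : {set V} => small_pair S A && (inord #|S| == s))) /=.
    rewrite (eq_bigl (fun S : {set V} => (S \subset A) && (small_pair S A && (inord #|S| == s)))); last first.
      by move=> S; rewrite andbA; congr andb; rewrite /small_pair; case: (S \subset A).
    rewrite -[leLHS]addr0; apply: lerD; last by apply: sumr_ge0.
    apply: ler_sum => S /and3P[_ _ /eqP <-]; by rewrite inordK // Aa.
  rewrite sumr_const -[_ *+ _]mulr_natl -natrX.
  have -> : #|[pred S : {set V} | S \subset A]| = (2 ^ a)%N.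
    by rewrite -Aa -card_powerset; apply: eq_card => S; rewrite !inE.
  by [].
rewrite (exchange_big_dep (fun s : 'I_n.+1 => (0 < s)%N && (4 * s <= n)%N)) /=; last first.
  by move=> a s _ /and4P[-> ->].
apply: ler_sum => s /andP[s0 s4].
have s3 : (3 * s <= n.+1)%N by lia.
rewrite (big_ord_widen_cond _ (fun a => (s <= a)%N) (fun a => 'C(n, a)%:R * 2 ^+ a * g s a) s3).
rewrite le_eqVlt; apply/orP; left; apply/eqP; apply: eq_bigl => a.
by rewrite /Q s0 s4 /= andbC.
Qed.

Lemma sum_geom_tail (R : realType) (r : R) (N : nat) : 0 <= r -> r <= 1 / 2 ->
  \sum_(i < N | (1 < i)%N) r ^+ i <= 2 * r ^+ 2.
Proof.
move=> r0 r12; have r2 : 0 <= r ^+ 2 by rewrite exprn_ge0.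
have geom M : \sum_(i < M) r ^+ i + 2 * r ^+ M <= 2.
  elim: M => [|M IH]; first by rewrite big_ord0 expr0 add0r mulr1.
  rewrite big_ord_recr /= exprS; apply: le_trans IH.
  have rM : 0 <= r ^+ M by rewrite exprn_ge0.
  have : r * r ^+ M <= 1 / 2 * r ^+ M by rewrite ler_wpM2r.
  lra.
case: N => [|[|M]]; rewrite big_mkcond.
- by rewrite big_ord0 mulr_ge0.
- by rewrite big_ord_recl big_ord0 /= addr0 mulr_ge0.
rewrite 2!big_ord_recl /= !add0r.
rewrite (eq_bigr (fun i : 'I_M => r ^+ 2 * r ^+ i)); last by move=> i _; rewrite /= -exprD.
rewrite -mulr_sumr mulrC ler_wpM2r //.
have := geom M; have : 0 <= r ^+ M by rewrite exprn_ge0.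
lra.
Qed.

(** Sets [S] of size one give the main term: there [A] has at most two vertices, the factor [l] it
    may bring is cancelled by the [ln l] in the slot number, and [expR (- C)] is left. As
    [n = expR l], [th] is a power of [l] times [n] to the power -1 / 10, so that all larger sets are
    negligible. *)
Lemma nonexpander_le (R : realType) (V : finType) (bl : seq bool) (C : R) :
  let n := #|V|%:R : R in let l := ln n in
  let L := (\sum_(b <- bl) (2 + b))%N in
  let K := 2 * expR 13 : R in let th := (K * l) ^+ 3 * expR (- (l / 10)) in
  0 <= C -> 1 <= l -> (30 <= #|V|)%N -> 9 * l <= n -> 4 * th <= 1 ->
  n * (l + ln l + C) <= L%:R -> L%:R <= 3 * n * l ->
  avgl (size bl) (fun t => (~~ `[< @expander V (block_graph (blocks bl t)) >])%:R) <=
  2 * K ^+ 2 * expR (1 - C) + 24 * th ^+ 2.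
Proof.
move=> n l L K th C0 l1 V30 ln9 th4 Llow Lup.
have V0 : (0 < #|V|)%N by apply: leq_trans V30.
have n0 : 0 < n by rewrite ltr0n.
have l0 : 0 < l by apply: lt_le_trans l1.
have K0 : 0 < K by rewrite mulr_gt0 // expR_gt0.
pose z (A : {set V}) : R := 1 + (density R A * l)^-1.
have z1 A : 1 <= z A by rewrite lerDl invr_ge0 mulr_ge0 // ?(ltW l0) // divr_ge0.
apply: le_trans (nonexpander_prob bl z1) _.
pose g (s a : nat) : R := ((a%:R / n) * l) ^+ a.-1 * expR (12 * a%:R) *
   expR (- (L%:R * ((s%:R / n) * (1 - a%:R / n)))).
have g0 s a : 0 <= g s a.
  by rewrite mulr_ge0 ?expR_ge0 // mulr_ge0 ?expR_ge0 // exprn_ge0 // mulr_ge0 ?(ltW l0) // divr_ge0 ?(ltW n0).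
apply: (@le_trans _ _ (\sum_(S : {set V}) \sum_(A | small_pair S A) g #|S| #|A|)).
  apply: ler_sum => S _; apply: ler_sum => A /and4P[SA S0 _ _].
  apply: pair_term_le => //; apply: leq_trans (subset_leq_card SA).
  by rewrite card_gt0.
apply: le_trans (sum_small_pairs V g0) _.
(* [K ^+ a] collects [2 ^+ a] for the choice of [S], [expR a] from the binomial coefficient and
   [expR (12 * a)] from [pair_term_le]. The factor [n] appears because the exponent [a.-1] is one
   short of what [bin_le_expr] absorbs. *)
have step1 (s a : nat) : (0 < s)%N -> (4 * s <= #|V|)%N -> (s <= a)%N -> (a < 3 * s)%N ->
  'C(#|V|, a)%:R * 2 ^+ a * g s a <=
  n * K ^+ a * l ^+ a.-1 * expR (- ((l + ln l + C) * (s%:R * (1 - 3 * s%:R / n)))).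
  move=> s0 s4 sa as3.
  have a0 : (0 < a)%N by apply: leq_trans s0 sa.
  have aR : 1 <= a%:R :> R by rewrite ler1n.
  rewrite /g exprMn.
  set E1 := expR (- (L%:R * _)); set E2 := expR (- (_ * (_ * _))).
  have hE : E1 <= E2.
    rewrite ler_expR lerN2.
    have h3 : 0 <= s%:R / n * (1 - a%:R / n).
      apply: mulr_ge0; first by rewrite divr_ge0 // ltW.
      rewrite subr_ge0 ler_pdivrMr // mul1r ler_nat; clear -s4 as3; lia.
    apply: le_trans (ler_wpM2r h3 Llow).
    have -> : n * (l + ln l + C) * (s%:R / n * (1 - a%:R / n)) =
       (l + ln l + C) * (s%:R * (1 - a%:R / n)) by field; rewrite lt0r_neq0.
    apply: ler_wpM2l; first by apply: addr_ge0 => //; apply: addr_ge0; [exact: ltW | exact: ln_ge0].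
    apply: ler_wpM2l => //; rewrite lerD2l lerN2 ler_wpM2r ?invr_ge0 ?(ltW n0) //.
    by rewrite -natrM ler_nat ltnW.
  have hb := bin_le_expr R a V0.
  have hK : K ^+ a = 2 ^+ a * (expR a%:R * expR (12 * a%:R)).
    rewrite /K exprMn -expRM_natr -expRD; congr (_ * expR _); ring.
  have hC : 'C(#|V|, a)%:R * (a%:R / n) ^+ a.-1 <= expR a%:R * n.
    have -> : 'C(#|V|, a)%:R * (a%:R / n) ^+ a.-1 = 'C(#|V|, a)%:R * (a%:R / n) ^+ a * (n / a%:R).
      have -> : (a%:R / n) ^+ a = a%:R / n * (a%:R / n) ^+ a.-1 by rewrite -exprS prednK.
      by field; rewrite !lt0r_neq0 // (lt_le_trans _ aR).
    apply: ler_pM.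
    - by apply: mulr_ge0 => //; apply: exprn_ge0; apply: divr_ge0 => //; exact: ltW.
    - by apply: divr_ge0 => //; exact: ltW.
    - exact: hb.
    - by rewrite ler_pdivrMr ?ler_peMr ?(ltW n0) // (lt_le_trans _ aR).
  have lp : 0 <= l ^+ a.-1 by rewrite exprn_ge0 // ltW.
  have -> : 'C(#|V|, a)%:R * 2 ^+ a * ((a%:R / n) ^+ a.-1 * l ^+ a.-1 * expR (12 * a%:R) * E1)
    = ('C(#|V|, a)%:R * (a%:R / n) ^+ a.-1) * (2 ^+ a * expR (12 * a%:R) * l ^+ a.-1) * E1 by ring.
  have -> : n * K ^+ a * l ^+ a.-1 * E2 =
     (expR a%:R * n) * (2 ^+ a * expR (12 * a%:R) * l ^+ a.-1) * E2 by rewrite hK; ring.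
  have h2 : 0 <= 2 ^+ a * expR (12 * a%:R) * l ^+ a.-1 :> R.
    by rewrite mulr_ge0 // mulr_ge0 ?expR_ge0 // exprn_ge0.
  have h1 : 0 <= 'C(#|V|, a)%:R * (a%:R / n) ^+ a.-1.
    by apply: mulr_ge0 => //; apply: exprn_ge0; apply: divr_ge0 => //; exact: ltW.
  apply: ler_pM; [exact: mulr_ge0 | exact: expR_ge0 | | exact: hE].
  exact: ler_wpM2r.
have K1 : 1 <= K.
  rewrite /K; have : 1 <= expR 13 :> R by rewrite ltW // expR_gt1.
  lra.
have Kl1 : 1 <= K * l by rewrite -[1]mulr1; apply: ler_pM.
have lC0 : 0 <= ln l + C by rewrite addr_ge0 // ln_ge0.
have th0 : 0 <= th by rewrite mulr_ge0 ?expR_ge0 // exprn_ge0 // mulr_ge0 // ltW.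
have step2 (a : nat) : (1 <= a)%N -> (a < 3)%N -> 
  'C(#|V|, a)%:R * 2 ^+ a * g 1%N a <= K ^+ 2 * expR (1 - C).
  move=> a1 a3; apply: le_trans (step1 1%N a _ _ a1 a3) _ => //; first by rewrite (leq_trans _ V30).
  have h1 : n * K ^+ a * l ^+ a.-1 <= n * K ^+ 2 * l.
    have ha : K ^+ a <= K ^+ 2 by apply: ler_weXn2l.
    have hl : l ^+ a.-1 <= l by rewrite -[leRHS]expr1; apply: ler_weXn2l => //; clear -a3; lia.
    apply: ler_pM; [apply: mulr_ge0; [exact: ltW | apply: exprn_ge0; exact: ltW] | apply: exprn_ge0; exact: ltW | | exact: hl].
    by apply: ler_wpM2l => //; exact: ltW.
  have h2 : expR (- ((l + ln l + C) * (1%:R * (1 - 3 * 1%:R / n)))) <= n^-1 * l^-1 * expR (1 - C).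
    have -> : n^-1 * l^-1 * expR (1 - C) = expR (- l + - ln l + (1 - C)).
      by rewrite !expRD !expRN !lnK ?posrE.
    rewrite ler_expR.
    (* The two bounds on [L] give [l + ln l + C <= 3 * l], so [9 * l <= n] suffices; the loss is the
       summand 1 in [expR (1 - C)]. *)
    have h3 : (l + ln l + C) * (3 / n) <= 1.
      rewrite mulrA ler_pdivrMr // mul1r.
      have : n * (l + ln l + C) <= n * (3 * l).
        by apply: le_trans Llow _; apply: le_trans Lup _; rewrite mulrCA mulrA.
      rewrite ler_pM2l //; lra.
    rewrite mul1r mulr1; move: h3; set w := 3 / n.
    lra.
  apply: le_trans (ler_pM _ _ h1 h2) _.
  - by rewrite !mulr_ge0 ?exprn_ge0 // ltW.
  - exact: expR_ge0.
  rewrite le_eqVlt; apply/orP; left; apply/eqP; field.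
  by rewrite !lt0r_neq0.
have step3 (s a : nat) : (2 <= s)%N -> (4 * s <= #|V|)%N -> (s <= a)%N -> (a < 3 * s)%N ->
  'C(#|V|, a)%:R * 2 ^+ a * g s a <= th ^+ s.
  move=> s2 s4 sa as3; apply: le_trans (step1 s a _ s4 sa as3) _; first exact: leq_trans s2.
  have sR : 2 <= s%:R :> R by rewrite ler_nat.
  have s4R : 4 * s%:R <= n by rewrite -natrM ler_nat.
  have nR : 30 <= n by rewrite ler_nat.
  have h1 : K ^+ a * l ^+ a.-1 <= (K * l) ^+ (3 * s).
    rewrite [leRHS]exprMn; apply: ler_pM; rewrite ?exprn_ge0 ?(ltW K0) ?(ltW l0) //.
      by apply: ler_weXn2l => //; exact: ltnW.
    by apply: ler_weXn2l => //; clear -as3; lia.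
  have h2 : expR (- ((l + ln l + C) * (s%:R * (1 - 3 * s%:R / n)))) <= n^-1 * expR (- (l / 10)) ^+ s.
    have nV : n^-1 = expR (- l) by rewrite expRN lnK ?posrE.
    rewrite [in leRHS]nV -expRM_natl -expRD ler_expR.
    (* The difference of the two sides is concave in [s], hence smallest at [s = 2] or [s = n / 4],
       where [30 <= n] is enough. The 1 on the left cancels the factor [n] of [step1], the rest is
       the decay in [th]. *)
    have h4 : 1 + s%:R / 10 <= s%:R * (1 - 3 * s%:R / n).
      rewrite -subr_ge0 -(pmulr_rge0 _ n0).
      have -> : n * (s%:R * (1 - 3 * s%:R / n) - (1 + s%:R / 10)) =
        (9 / 10) * (n * s%:R) - 3 * s%:R ^+ 2 - n by field; rewrite lt0r_neq0.
      have : 0 <= (s%:R - 2) * (n - 4 * s%:R) by rewrite mulr_ge0 // subr_ge0.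
      have : 0 <= (s%:R - 2) * (n - 30) by rewrite mulr_ge0 // subr_ge0.
      rewrite expr2; lra.
    have h5 : l * (1 + s%:R / 10) <= (l + ln l + C) * (s%:R * (1 - 3 * s%:R / n)).
      apply: ler_pM => //; [exact: ltW | by rewrite addr_ge0 // divr_ge0 | by rewrite -addrA lerDl].
    move: h5; set w := (l + ln l + C) * _ => h5.
    lra.
  have -> : n * K ^+ a * l ^+ a.-1 = n * (K ^+ a * l ^+ a.-1) by rewrite mulrA.
  apply: le_trans (ler_pM _ _ (ler_wpM2l (ltW n0) h1) h2) _.
  - by rewrite !mulr_ge0 ?exprn_ge0 // ltW.
  - exact: expR_ge0.
  rewrite /th [in leRHS]exprMn -exprM le_eqVlt; apply/orP; left; apply/eqP; field.
  by rewrite !lt0r_neq0.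
rewrite (bigD1 (Ordinal (leq_trans (isT : (1 < 30)%N) (leqW V30)))) /=; last exact: leq_trans V30.
have r0 : 0 <= 2 * th by rewrite mulr_ge0.
apply: lerD.
  rewrite big_mkcond !big_ord_recl big_ord0 /= add0r addr0.
  have h1 := step2 1%N isT isT; have h2 := step2 2%N isT isT.
  apply: le_trans (lerD h1 h2) _.
  by rewrite le_eqVlt; apply/orP; left; apply/eqP; ring.
(* There are at most [3 * i <= 3 * 2 ^ i] values of [a], which leaves a geometric tail in [2 * th];
   the constant 24 is [3 * 2 * 2 ^ 2]. *)
apply: (@le_trans _ _ (\sum_(i < #|V|.+1 | (1 < i)%N) 3 * (2 * th) ^+ i)).
  rewrite [leRHS](bigID (fun i : 'I_#|V|.+1 => (4 * i <= #|V|)%N)) /=.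
  rewrite -[leLHS]addr0; apply: lerD; last by apply: sumr_ge0 => i _; rewrite mulr_ge0 ?exprn_ge0.
  rewrite (eq_bigl (fun i : 'I_#|V|.+1 => (1 < i)%N && (4 * i <= #|V|)%N)); last first.
    by move=> i; rewrite andbAC -val_eqE /=; case: (nat_of_ord i) => [|[|k]].
  apply: ler_sum => i /andP[i1 i4].
  apply: (@le_trans _ _ (\sum_(a < 3 * i) th ^+ i)).
    rewrite [leRHS](bigID (fun a : 'I_(3 * i) => (i <= a)%N)) /=.
    rewrite -[leLHS]addr0; apply: lerD; last by apply: sumr_ge0 => a _; rewrite exprn_ge0.
    by apply: ler_sum => a ia; apply: step3.
  rewrite sumr_const card_ord -[_ *+ _]mulr_natl natrM [(2 * th) ^+ _]exprMn -mulrA ler_wpM2l //.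
  by rewrite ler_wpM2r ?exprn_ge0 // -natrX ler_nat ltnW // ltn_expl.
rewrite -mulr_sumr.
have := @sum_geom_tail R (2 * th) #|V|.+1 r0; set X := \sum_(_ < _ | _) _ => h.
have {h} : X <= 2 * (2 * th) ^+ 2 by apply: h; lra.
rewrite [(2 * th) ^+ _]exprMn; lra.
Qed.

Lemma exists_prefix (R : realType) (bl : seq bool) (T : R) :
  0 <= T -> T <= (\sum_(b <- bl) (2 + b))%N%:R ->
  exists bl1 bl2, bl = bl1 ++ bl2 /\
    T <= (\sum_(b <- bl1) (2 + b))%N%:R <= T + 3.
Proof.
elim/last_ind: bl => [|bl b IH] T0.
  rewrite big_nil => Tle; exists [::], [::]; split => //.
  by rewrite big_nil Tle addr_ge0.
have [h _|h] := leP T (\sum_(b <- bl) (2 + b))%N%:R.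
  have [bl1 [bl2 [-> hh]]] := IH T0 h.
  by exists bl1, (rcons bl2 b); rewrite rcons_cat.
move=> h2; exists (rcons bl b), [::]; rewrite cats0 h2; split => //=.
rewrite -cats1 big_cat big_seq1 natrD; apply: lerD; first exact: ltW.
by case: b {h2}; rewrite ler_nat.
Qed.

Lemma blocks_cat (V : Type) (bl1 bl2 : seq bool) (l1 l2 : seq (V * V * V)) :
  size l1 = size bl1 -> blocks (bl1 ++ bl2) (l1 ++ l2) = blocks bl1 l1 ++ blocks bl2 l2.
Proof. by move=> h; rewrite /blocks zip_cat // map_cat. Qed.

(** The second round has to beat the initial value [2 ^+ #|V|.+1] of [sprinkling]. With 96 blocks
    per vertex this works because [(31 / 32) ^+ 96 <= 1 / 8], which follows from Bernoulli's
    inequality [2 <= (32 / 31) ^+ 32]. *)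
Lemma expander_hamiltonian (R : realType) (V : finType) (bl1 bl2 : seq bool) :
  (12 <= #|V|)%N -> (96 * #|V| <= size bl2)%N ->
  avgl (size (bl1 ++ bl2)) (fun l => (~~ has_hamilton_cycle
     (block_graph (blocks (bl1 ++ bl2) l) : rel V))%:R) <=
  avgl (size bl1) (fun l => (~~ `[< @expander V (block_graph (blocks bl1 l)) >])%:R)
   + 2 / 4 ^+ #|V| :> R.
Proof.
move=> V12 sb; rewrite size_cat avgl_cat.
have T0 : (0 < #|{: V * V * V}|)%N by rewrite !card_prod !muln_gt0; apply/andP; split; [apply/andP; split|]; apply: leq_trans V12.
rewrite -[X in _ + X](avgl_cst (T := (V * V * V)%type) (size bl1)) // -avglD.
apply: avgl_le => l1 s1.
rewrite (eq_avgl (g := fun l2 => (~~ has_hamilton_cycle (block_graph (blocks bl1 l1 ++ blocks bl2 l2)))%:R)); last first.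
  by move=> l2 _; rewrite blocks_cat.
case: asboolP => [exp|_]; last first.
  apply: (@le_trans _ _ 1); last by rewrite lerDl divr_ge0 ?exprn_ge0.
  rewrite -[leRHS](avgl_cst (T := (V * V * V)%type) (size bl2)) //.
  by apply: avgl_le => l2 _; rewrite lern1 leq_b1.
have [P lP] := exists_longest_path (block_graph (blocks bl1 l1)).
rewrite add0r; apply: le_trans (sprinkling R bl2 V12 exp lP) _.
have q0 : 0 <= 31 / 32 :> R by rewrite divr_ge0.
have q1 : 31 / 32 <= 1 :> R by lra.
apply: (@le_trans _ _ (2 ^+ #|V|.+1 * (31 / 32) ^+ (96 * #|V|))).
  apply: ler_pM; rewrite ?exprn_ge0 //.
    by apply: ler_weXn2l; rewrite ?ler1n // leq_subr.
  by apply: ler_wiXn2l.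
have q8 : (31 / 32) ^+ 96 <= 1 / 8 :> R.
  have h : 2 <= (32 / 31) ^+ 32 :> R.
    have -> : 32 / 31 = 1 + 1 / 31 :> R by field.
    have : 1 + 32%:R * (1 / 31) <= (1 + 1 / 31) ^+ 32 :> R.
      elim: 32%N => [|k IH]; first by rewrite expr0; lra.
      rewrite exprS -natr1.
      have : 0 <= k%:R :> R by [].
      have : (1 + 1 / 31) * (1 + k%:R * (1 / 31)) <= (1 + 1 / 31) * (1 + 1 / 31) ^+ k :> R.
        by rewrite ler_wpM2l //; lra.
      lra.
    lra.
  have -> : 31 / 32 = (32 / 31)^-1 :> R by field.
  rewrite exprVn -[96%N]/(32 * 3)%N exprM div1r lef_pV2 ?posrE; last 2 first.
  - by apply: exprn_gt0; apply: exprn_gt0; rewrite divr_gt0.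
  - by [].
  have -> : 8 = 2 ^+ 3 :> R by ring.
  by rewrite lerXn2r // nnegrE ?(le_trans _ h).
rewrite exprM exprS -mulrA ler_wpM2l //.
have -> : 2 ^+ #|V| * ((31 / 32) ^+ 96) ^+ #|V| = (2 * (31 / 32) ^+ 96) ^+ #|V| :> R.
  by rewrite [RHS]exprMn.
rewrite -exprVn lerXn2r ?nnegrE //; last lra.
  by rewrite mulr_ge0 // exprn_ge0.
by rewrite invr_ge0.
Qed.

Lemma blocks_hamiltonian (R : realType) (eps : R) : 0 < eps ->
  exists C M : R, forall (V : finType) (bl : seq bool), M <= ln #|V|%:R ->
  #|V|%:R * (ln #|V|%:R + ln (ln #|V|%:R) + C) <= (\sum_(b <- bl) (2 + b))%N%:R ->
  avgl (size bl) (fun l => (~~ has_hamilton_cycle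
     (block_graph (blocks bl l) : rel V))%:R) <= eps.
Proof.
move=> e0; pose K := 2 * expR 13 : R.
have K0 : 0 < K by rewrite mulr_gt0 // expR_gt0.
(* Chosen so that the term of the one-vertex sets in [nonexpander_le] is at most [eps / 3]. *)
pose C1 := 1 + Num.max 0 (ln (6 * K ^+ 2 / eps)).
have C1_ge1 : 1 <= C1 by rewrite lerDl le_max lexx.
have hC1 : 2 * K ^+ 2 * expR (1 - C1) <= eps / 3.
  have K2 : 0 < 6 * K ^+ 2 / eps by rewrite divr_gt0 // mulr_gt0 // exprn_gt0.
  have : expR (1 - C1) <= (6 * K ^+ 2 / eps)^-1.
    rewrite -[leRHS]lnK ?posrE ?invr_gt0 // lnV ?posrE // ler_expR.
    by rewrite /C1 opprD addrA subrr add0r lerN2 le_max lexx orbT.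
  move=> h; apply: le_trans (ler_wpM2l _ h) _; first by rewrite mulr_ge0 // exprn_ge0 // ltW.
  rewrite le_eqVlt; apply/orP; left; apply/eqP; field.
  by rewrite !lt0r_neq0.
pose dl := Num.min (1 / 4) (eps / 72).
have dl0 : 0 < dl by rewrite lt_min !divr_gt0.
(* In this order: 18 makes [n] at least [9 * l] and 162, since [l ^+ 2 / 2 <= n]; [C1 + 1] keeps the
   first round below [3 * n * l] slots; [6 / eps] handles the second round; the last entry gives
   [th <= dl] by the fourth order term of the exponential. *)
pose M := Num.max 18 (Num.max (C1 + 1) (Num.max (6 / eps) (24 * 10 ^+ 4 * K ^+ 3 / dl))).
(* The second round keeps [300 * n - 3] slots, at least the [3 * 96 * n] that guarantee [96 * n]
   blocks. *)
exists (C1 + 300), M => V bl.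
set n := #|V|%:R : R; set l := ln n.
rewrite /M !ge_max => /and4P[l18 lC le ld] hL.
have l0 : 0 < l by apply: lt_le_trans l18.
have n0 : 0 < n.
  rewrite lt_neqAle ler0n andbT eq_sym; apply/eqP => n00.
  by move: l0; rewrite /l n00 ln0 ?ltxx.
have nE : n = expR l by rewrite lnK.
have n2 : l ^+ 2 / 2 <= n by rewrite nE; apply: le_trans (expR_ge1Dxn 1 (ltW l0)); rewrite lerDr.
have ln : l <= n by rewrite nE; apply: le_trans (expR_ge1Dx l); rewrite lerDr.
have ln9 : 9 * l <= n.
  by apply: le_trans n2; rewrite expr2 ler_pdivlMr //; have := ler_wpM2r (ltW l0) l18; lra.
have V162 : (162 <= #|V|)%N by rewrite -(ler_nat R) -/n; lra.
have lnl0 : 0 <= exp.ln l by apply: ln_ge0; lra.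
have lnll : exp.ln l < l by exact: ln_sublinear.
set th := (K * l) ^+ 3 * expR (- (l / 10)).
have th0 : 0 <= th by rewrite mulr_ge0 ?expR_ge0 // exprn_ge0 // mulr_ge0 // ltW.
have thd : th <= dl.
  have l10 : 0 <= l / 10 by rewrite divr_ge0 // ltW.
  have h : (l / 10) ^+ 4 / 24 <= expR (l / 10).
    by apply: le_trans (expR_ge1Dxn 3 l10); rewrite lerDr.
  have h2 : expR (- (l / 10)) <= 24 * 10 ^+ 4 / l ^+ 4.
    rewrite expRN -[leRHS]invrK lef_pV2 ?posrE ?expR_gt0 ?invr_gt0 ?divr_gt0 ?exprn_gt0 //.
    apply: le_trans h; rewrite le_eqVlt; apply/orP; left; apply/eqP; field.
      by rewrite lt0r_neq0.
    by rewrite mulr_gt0 // exprn_gt0.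
  have h3 : 0 <= (K * l) ^+ 3 by rewrite exprn_ge0 // mulr_ge0 // ltW.
  apply: le_trans (ler_wpM2l h3 h2) _.
  have -> : (K * l) ^+ 3 * (24 * 10 ^+ 4 / l ^+ 4) = 24 * 10 ^+ 4 * K ^+ 3 / l by field; rewrite lt0r_neq0.
  by rewrite ler_pdivrMr // [dl * l]mulrC -ler_pdivrMr.
have th4 : 4 * th <= 1.
  have : dl <= 1 / 4 by rewrite ge_min lexx.
  lra.
have th2 : 24 * th ^+ 2 <= eps / 3.
  have : dl <= eps / 72 by rewrite ge_min lexx orbT.
  have : th * th <= th by rewrite ler_piMl //; lra.
  rewrite expr2; lra.
have T0 : 0 <= n * (l + exp.ln l + C1) by rewrite mulr_ge0 ?(ltW n0) //; lra.
have [|bl1 [bl2 [blE /andP[L1 L2]]]] := @exists_prefix R bl (n * (l + exp.ln l + C1)) T0.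
  by apply: le_trans hL; rewrite ler_pM2l //; lra.
have sb2 : (96 * #|V| <= size bl2)%N.
  have c : (\sum_(b <- bl2) (2 + b) <= 3 * size bl2)%N.
    elim: (bl2) => [|b s IH]; first by rewrite big_nil.
    rewrite big_cons /= mulnS leq_add //.
    by rewrite -[3%N]/(2 + 1)%N leq_add2l leq_b1.
  rewrite -(leq_pmul2l (isT : (0 < 3)%N)); apply: leq_trans c.
  rewrite -(ler_nat R) mulnA natrM -/n.
  move: hL L2; rewrite blE big_cat natrD /=.
  set x := (\sum_(i <- bl1) _)%N%:R; set y := (\sum_(i <- bl2) _)%N%:R.
  have : 3 <= n by lra.
  rewrite [n * (_ + (C1 + 300))]mulrDr [n * (C1 + 300)]mulrDr [n * (_ + C1)]mulrDr.
  lra.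
have V12 : (12 <= #|V|)%N by apply: leq_trans V162.
rewrite blE; apply: le_trans (@expander_hamiltonian R V bl1 bl2 V12 sb2) _.
have hK : 2 / 4 ^+ #|V| <= eps / 3.
  have h4 : n <= 4 ^+ #|V| by rewrite -natrX ler_nat ltnW // ltn_expl.
  have n6 : 6 / eps <= n by apply: le_trans ln.
  have V4 : 0 < 4 ^+ #|V| :> R by rewrite exprn_gt0.
  rewrite ler_pdivrMr //.
  have : eps / 3 * (6 / eps) <= eps / 3 * 4 ^+ #|V|.
    by rewrite ler_wpM2l ?divr_ge0 ?(ltW e0) // (le_trans n6).
  have -> : eps / 3 * (6 / eps) = 2 by field; rewrite lt0r_neq0.
  by [].
have L3 : (\sum_(b <- bl1) (2 + b))%N%:R <= 3 * n * l.
  apply: le_trans L2 _.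
  have -> : 3 * n * l = n * (3 * l) by ring.
  have : n * (l + exp.ln l + C1 + 1) <= n * (3 * l) by rewrite ler_pM2l //; lra.
  rewrite [n * (_ + 1)]mulrDr mulr1; have : 3 <= n by lra.
  lra.
have V30 : (30 <= #|V|)%N by apply: leq_trans V162.
have l1 : 1 <= l by lra.
have C10 : 0 <= C1 by lra.
have := @nonexpander_le R V bl1 C1 C10 l1 V30 ln9 th4 L1 L3.
rewrite -/n -/l -/K -/th => h.
apply: le_trans (lerD h hK) _; lra.
Qed.

(** * Comparison with random blocks *)

From mathcomp Require Import all_fingroup.

Definition subset_law (R : realFieldType) (V : finType) (p : R) (B : {set V}) : R :=
  \prod_v (if v \in B then p else 1 - p).

(** The feature assignment transposed: indexed by features, it has independent entries whose laws
    are invariant under permutations of the vertices. *)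
Definition family_law (R : realFieldType) (V I : finType) (p : I -> R)
    (A : {ffun I -> {set V}}) : R := \prod_i subset_law (p i) (A i).

Definition family_graph (V I : finType) (A : {ffun I -> {set V}}) : rel V :=
  fun u v => (u != v) && [exists i, (u \in A i) && (v \in A i)].

Lemma sum_prod_set (R : realFieldType) (V : finType) (F G : V -> R) :
  \sum_(B : {set V}) \prod_v (if v \in B then F v else G v) = \prod_v (F v + G v).
Proof. by rewrite bigA_distr; apply: eq_bigl => B; rewrite inE. Qed.

Lemma subset_law_cylinder (R : realFieldType) (V : finType) (p : R) (D1 D0 : {set V}) :
  [disjoint D1 & D0] ->
  \sum_(B : {set V} | (D1 \subset B) && [disjoint D0 & B]) subset_law p B =
  p ^+ #|D1| * (1 - p) ^+ #|D0|.
Proof.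
move=> dis.
pose F v := if v \in D0 then 0 else p; pose G v := if v \in D1 then 0 else 1 - p.
transitivity (\sum_(B : {set V}) \prod_v (if v \in B then F v else G v)).
  rewrite big_mkcond; apply: eq_bigr => B _; case: ifP => [/andP[/subsetP D1B D0B]|].
    apply: eq_bigr => v _; rewrite /F /G; case: ifP => vB.
      by rewrite (disjointFl D0B).
    by case: ifP => // /D1B; rewrite vB.
  move=> /negbT; rewrite negb_and => /orP[/subsetPn[v vD vB]|].
    by rewrite (bigD1 v) //= (negbTE vB) /G vD mul0r.
  rewrite -setI_eq0 => /set0Pn[v]; rewrite inE => /andP[vD vB].
  by rewrite (bigD1 v) //= vB /F vD mul0r.
rewrite sum_prod_set -!prodr_const [X in X * _]big_mkcond [X in _ * X]big_mkcond -big_split.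
apply: eq_bigr => v _; rewrite /F /G /=.
have [vD1|vD1] := boolP (v \in D1).
  by rewrite (disjointFr dis vD1) addr0 mulr1.
by case: ifP; rewrite ?add0r mul1r // addrC subrK.
Qed.

Lemma subset_law_sum1 (R : realFieldType) (V : finType) (p : R) :
  \sum_(B : {set V}) subset_law p B = 1.
Proof.
rewrite /subset_law (sum_prod_set (fun=> p) (fun=> 1 - p)).
by rewrite big1 // => v _; rewrite addrC subrK.
Qed.

Lemma subset_law_ge0 (R : realFieldType) (V : finType) (p : R) (B : {set V}) :
  0 <= p <= 1 -> 0 <= subset_law p B.
Proof.
move=> /andP[p0 p1]; apply: prodr_ge0 => v _; case: ifP => // _; by rewrite subr_ge0.
Qed.

Lemma subset_law_card (R : realFieldType) (V : finType) (p : R) (B : {set V}) :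
  subset_law p B = p ^+ #|B| * (1 - p) ^+ #|~: B|.
Proof.
rewrite -!prodr_const [X in X * _]big_mkcond [X in _ * X]big_mkcond -big_split.
by apply: eq_bigr => v _; rewrite inE /=; case: ifP; rewrite ?mulr1 ?mul1r.
Qed.

Lemma family_expectation_prod (R : realFieldType) (V I : finType) (p : I -> R)
    (F : I -> {set V} -> R) :
  \sum_(A : {ffun I -> {set V}}) family_law p A * \prod_i F i (A i) =
  \prod_i \sum_B subset_law (p i) B * F i B.
Proof.
rewrite bigA_distr_bigA; apply: eq_bigr => A _.
by rewrite -big_split.
Qed.

Lemma family_law_ge0 (R : realFieldType) (V I : finType) (p : I -> R)
    (A : {ffun I -> {set V}}) : (forall i, 0 <= p i <= 1) -> 0 <= family_law p A.
Proof. by move=> p01; apply: prodr_ge0 => i _; apply: subset_law_ge0. Qed.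

Lemma family_law_sum1 (R : realFieldType) (V I : finType) (p : I -> R) :
  \sum_(A : {ffun I -> {set V}}) family_law p A = 1.
Proof.
rewrite /family_law -(bigA_distr_bigA (fun i (B : {set V}) => subset_law (p i) B)).
by rewrite big1 // => i _; rewrite subset_law_sum1.
Qed.

Definition permute_family (V I : finType) (s : {ffun I -> {perm V}})
    (A : {ffun I -> {set V}}) : {ffun I -> {set V}} := [ffun i => s i @: A i].

Lemma permute_family_inj (V I : finType) (s : {ffun I -> {perm V}}) :
  injective (permute_family s).
Proof.
move=> A A' h; apply/ffunP => i.
have := congr1 (fun F : {ffun I -> {set V}} => F i) h; rewrite !ffunE.
by apply: imset_inj; apply: perm_inj.
Qed.

Lemma family_law_permute (R : realFieldType) (V I : finType) (p : I -> R) s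
    (A : {ffun I -> {set V}}) : family_law p (permute_family s A) = family_law p A.
Proof.
apply: eq_bigr => i _; rewrite ffunE !subset_law_card.
have h := card_imset (A i) (@perm_inj _ (s i)); rewrite h.
have := cardsC (A i); have := cardsC (s i @: A i); rewrite h => <- /eqP.
by rewrite eqn_add2l => /eqP ->.
Qed.

Lemma permute_familyM (V I : finType) (s t : {ffun I -> {perm V}}) A :
  permute_family s (permute_family t A) = permute_family [ffun i => (t i * s i)%g] A.
Proof.
apply/ffunP => i; rewrite !ffunE -imset_comp; apply: eq_imset => v.
by rewrite /= permM.
Qed.

Lemma family_expectation_symm (R : realFieldType) (V I : finType) (p : I -> R)
    (g : {ffun I -> {set V}} -> R) :
  \sum_A family_law p A * g A =
  \sum_A family_law p A * avg (fun s : {ffun I -> {perm V}} => g (permute_family s A)).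
Proof.
have T0 : (0 < #|{: {ffun I -> {perm V}}}|)%N by apply/card_gt0P; exists [ffun=> 1%g].
rewrite -[LHS](avg_cst (T := {ffun I -> {perm V}})) //.
under [RHS]eq_bigr do rewrite -avgZ.
rewrite -avg_sum; apply: eq_avg => s.
rewrite (reindex_inj (@permute_family_inj _ _ s)) /=.
by apply: eq_bigr => A _; rewrite family_law_permute.
Qed.

Lemma exists_perm_cover (V : finType) (U B : {set V}) :
  (#|U| <= #|B|)%N -> exists s : {perm V}, U \subset s @: B.
Proof.
move=> UB; pose eB := enum B ++ enum (~: B); pose eU := enum U ++ enum (~: U).
have inE' (D : {set V}) v : v \in enum D ++ enum (~: D).
  by rewrite mem_cat !mem_enum inE orbN.
have un (D : {set V}) : uniq (enum D ++ enum (~: D)).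
  rewrite cat_uniq !enum_uniq /= andbT; apply/hasPn => v.
  by rewrite !mem_enum inE.
have sz (D : {set V}) : size (enum D ++ enum (~: D)) = #|V|.
  by rewrite size_cat -!cardE cardsC.
have [->|/set0Pn[v0 _]] := eqVneq U set0; first by exists 1%g; rewrite sub0set.
(* Both lists enumerate all vertices, one beginning with [B], the other with [U]; matching positions
   sends an initial part of [B] onto [U]. *)
pose f v := nth v0 eU (index v eB).
have fI : injective f.
  move=> u v /eqP; rewrite /f nth_uniq ?un // ?sz -?(sz B) ?index_mem ?inE' //.
  by move=> /eqP /(congr1 (nth v0 eB)); rewrite !nth_index ?inE'.
exists (perm fI); apply/subsetP => u uU; apply/imsetP.
exists (nth v0 eB (index u eU)).
  have iu : (index u eU < #|B|)%N.
    apply: leq_trans UB; rewrite /eU index_cat mem_enum uU cardE index_mem.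
    by rewrite mem_enum.
  by rewrite /eB nth_cat -cardE iu -mem_enum mem_nth // -cardE.
rewrite permE /f index_uniq ?un //; first by rewrite nth_index ?inE'.
by rewrite sz -(sz U) index_mem inE'.
Qed.

Definition block_family (V I : finType) (bl : seq (I * bool)) (l : seq (V * V * V)) :
    {ffun I -> {set V}} :=
  [ffun i => [set v | has (fun x => (x.1.1 == i) && (v \in block x.1.2 x.2)) (zip bl l)]].

Lemma card_block_family (V I : finType) (bl : seq (I * bool)) (l : seq (V * V * V)) i :
  (#|block_family bl l i| <= \sum_(b <- bl | b.1 == i) (2 + b.2))%N.
Proof.
elim: bl l => [|b bl IH] [|y l].
- by rewrite ffunE big_nil eq_card0 // => v; rewrite !inE.
- by rewrite ffunE big_nil eq_card0 // => v; rewrite !inE.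
- by rewrite ffunE eq_card0 // => v; rewrite !inE.
rewrite big_cons; have := IH l; rewrite !ffunE => {}IH.
case: ifP => bi.
  apply: (@leq_trans (#|[set v | v \in block b.2 y] :|: [set v | has (fun x => (x.1.1 == i) && (v \in block x.1.2 x.2)) (zip bl l)]|)).
    by apply/subset_leq_card/subsetP => v; rewrite !inE /= bi.
  apply: leq_trans (leq_card_setU _ _) _; apply: leq_add => //.
  rewrite cardsE; apply: leq_trans (card_size _) _.
  by rewrite /block; case: (b.2).
apply: leq_trans IH; apply/subset_leq_card/subsetP => v; by rewrite !inE /= bi.
Qed.

Definition permute_triple (V : finType) (s : {perm V}) (y : V * V * V) : V * V * V :=
  (s y.1.1, s y.1.2, s y.2).

Lemma permute_block (V : finType) (s : {perm V}) b (y : V * V * V) v :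
  (s v \in block b (permute_triple s y)) = (v \in block b y).
Proof. by rewrite /block; case: b; rewrite !inE !(inj_eq perm_inj). Qed.

Lemma permute_block_family (V I : finType) (s : {ffun I -> {perm V}}) bl l :
  block_family bl [seq permute_triple (s x.1.1) x.2 | x <- zip bl l] =
  permute_family s (block_family bl l).
Proof.
apply/ffunP => i; apply/setP => w; rewrite -(permKV (s i) w).
move: ((s i)^-1%g w) => v; rewrite !ffunE mem_imset; last exact: perm_inj.
rewrite !inE; elim: bl l => [|b bl IH] [|y l] //=.
rewrite IH; congr (_ || _); case: eqP => //= <-; exact: permute_block.
Qed.

(* Averaging over independent permutations leaves only the sizes of the sets visible, and
   [block_family bl l] has at most #|A i| vertices in feature [i]. *)
Lemma coupling (R : realFieldType) (V I : finType) (A : {ffun I -> {set V}})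
    (bl : seq (I * bool)) (g : {ffun I -> {set V}} -> R) :
  (0 < #|V|)%N ->
  (forall A1 A2 : {ffun I -> {set V}}, (forall i, A1 i \subset A2 i) -> g A2 <= g A1) ->
  (forall i, (\sum_(b <- bl | b.1 == i) (2 + b.2) <= #|A i|)%N) ->
  avg (fun s : {ffun I -> {perm V}} => g (permute_family s A)) <=
  avgl (size bl) (fun l => g (block_family bl l)).
Proof.
move=> V0 anti hA.
have T0 : (0 < #|{: V * V * V}|)%N by rewrite !card_prod !muln_gt0 V0.
have S0 : (0 < #|{: {ffun I -> {perm V}}}|)%N by apply/card_gt0P; exists [ffun=> 1%g].
(* Permuting uniform samples feature by feature leaves them uniform, so the blocks may be averaged
   over the same permutations as [A]. *)
have -> : avgl (size bl) (fun l => g (block_family bl l)) =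
    avgl (size bl) (fun l => avg (fun s : {ffun I -> {perm V}} => g (permute_family s (block_family bl l)))).
  rewrite -[LHS](avg_cst (T := {ffun I -> {perm V}})) //.
  transitivity (avg (fun s : {ffun I -> {perm V}} => avgl (size bl) (fun l => g (permute_family s (block_family bl l))))).
    apply: eq_avg => s.
    rewrite -(@avgl_map_perm R _ _ bl (fun b : I * bool => permute_triple (s b.1))); last first.
      move=> b [[u v] w] [[u' v'] w'] [/perm_inj -> /perm_inj -> /perm_inj ->] //.
    by apply: eq_avgl => l _; rewrite permute_block_family.
  rewrite /avg mulrC -avgl_sum -avglZ; apply: eq_avgl => l _; by rewrite mulrC.
rewrite -[leLHS](avgl_cst (T := (V * V * V)%type) (size bl)) //.
apply: avgl_le => l _.
(* For fixed [l], [t] moves each [A i] over the blocks of feature [i]. Composition with [t] is a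
   bijection on families of permutations, so the average does not notice it, and monotonicity of [g]
   finishes. *)
have /choice[t ht] : forall i, exists s : {perm V}, block_family bl l i \subset s @: A i.
  by move=> i; apply: exists_perm_cover; apply: leq_trans (card_block_family _ _ _) (hA i).
apply: (@le_trans _ _ (avg (fun s : {ffun I -> {perm V}} => g (permute_family s (permute_family [ffun i => t i] A))))).
  rewrite le_eqVlt; apply/orP; left; apply/eqP; rewrite /avg; congr (_ / _).
  have inj : injective (fun s : {ffun I -> {perm V}} => [ffun i => (t i * s i)%g]).
    move=> s s' /ffunP h; apply/ffunP => i; have := h i; rewrite !ffunE; exact: mulgI.
  rewrite (reindex_inj inj) /=; apply: eq_bigr => s _.
  rewrite permute_familyM; congr (g (permute_family _ _)).
  by apply/ffunP => i; rewrite !ffunE.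
apply: avg_le => s; apply: anti => i; rewrite !ffunE.
by have := ht i; rewrite !ffunE => h; apply: imsetS.
Qed.

(** * Lower tail of the number of slots *)

Lemma expRN_le (R : realType) (x : R) : 0 <= x -> expR (- x) <= 1 - x + x ^+ 2.
Proof.
move=> x0; rewrite expRN -div1r ler_pdivrMr ?expR_gt0 //.
have q0 : 0 <= 1 - x + x ^+ 2.
  by have := sqr_ge0 (1 - x); rewrite !expr2; lra.
apply: le_trans (ler_wpM2l q0 (expR_ge1Dx x)).
have -> : (1 - x + x ^+ 2) * (1 + x) = 1 + x ^+ 3 by ring.
by rewrite lerDl exprn_ge0.
Qed.

(** Exponential Markov inequality. For nonnegative [Z] the bound [expRN_le] is valid without an
    upper limit on [Z], so second moments suffice; [la] minimises the resulting quadratic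
    exponent. *)
Lemma lower_tail (R : realType) (I X : finType) (w Z : I -> X -> R) (mu v T : R) :
  (forall i x, 0 <= w i x) -> (forall i, \sum_x w i x = 1) ->
  (forall i x, 0 <= Z i x) ->
  mu = \sum_i \sum_x w i x * Z i x ->
  \sum_i \sum_x w i x * Z i x ^+ 2 <= v -> 0 < v -> T <= mu ->
  \sum_(A : {ffun I -> X} | \sum_i Z i (A i) < T) \prod_i w i (A i) <=
  expR (- ((mu - T) ^+ 2 / (4 * v))).
Proof.
move=> w0 w1 Z0 muE vE v0 Tmu.
pose la := (mu - T) / (2 * v).
have la0 : 0 <= la by rewrite divr_ge0 ?subr_ge0 // mulr_ge0 // ltW.
apply: (@le_trans _ _ (\sum_(A : {ffun I -> X}) expR (la * T) *
    \prod_i (w i (A i) * expR (- (la * Z i (A i)))))).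
  rewrite big_mkcond; apply: ler_sum => A _.
  have p0 : 0 <= \prod_i w i (A i) by apply: prodr_ge0.
  rewrite big_split /= mulrCA -expR_sum -expRD; case: ifP => [h|_]; last first.
    by rewrite mulr_ge0 // expR_ge0.
  rewrite ler_peMr // -expR0 ler_expR sumrN -mulr_sumr -mulrBr mulr_ge0 // subr_ge0.
  exact: ltW.
rewrite -mulr_sumr -(bigA_distr_bigA (fun i x => w i x * expR (- (la * Z i x)))).
have E0 i : 0 <= \sum_x w i x * expR (- (la * Z i x)).
  by apply: sumr_ge0 => x _; rewrite mulr_ge0 // expR_ge0.
have h : \prod_i \sum_x w i x * expR (- (la * Z i x)) <=
    \prod_i expR (- (la * \sum_x w i x * Z i x) + la ^+ 2 * \sum_x w i x * Z i x ^+ 2).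
  apply: ler_prod => i _; rewrite E0 /=; apply: le_trans _ (expR_ge1Dx _).
  rewrite -[X in X + _](w1 i) !mulr_sumr -sumrN -!big_split /=; apply: ler_sum => x _.
  have -> : w i x + (- (la * (w i x * Z i x)) + la ^+ 2 * (w i x * Z i x ^+ 2)) =
     w i x * (1 - la * Z i x + (la * Z i x) ^+ 2) by ring.
  by rewrite ler_wpM2l // expRN_le // mulr_ge0.
apply: le_trans (ler_wpM2l (expR_ge0 _) h) _.
rewrite -expR_sum -expRD ler_expR big_split /= sumrN -!mulr_sumr -muE.
apply: (@le_trans _ _ (la * T + (- (la * mu) + la ^+ 2 * v))).
  by rewrite !lerD2l ler_wpM2l // sqr_ge0.
rewrite le_eqVlt; apply/orP; left; apply/eqP; rewrite /la; field.
by rewrite lt0r_neq0.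
Qed.

(* A feature held by a single vertex creates no edge. *)
Definition shared_card (V : finType) (B : {set V}) : nat := if (#|B| < 2)%N then 0%N else #|B|.

Lemma subset_law_card_mean (R : realFieldType) (V : finType) (p : R) :
  \sum_(B : {set V}) subset_law p B * #|B|%:R = #|V|%:R * p.
Proof.
transitivity (\sum_(B : {set V}) \sum_v subset_law p B * (v \in B)%:R).
  apply: eq_bigr => B _; rewrite -mulr_sumr -natr_sum; congr (_ * _%:R).
  by rewrite -sum1_card big_mkcond; apply: eq_bigr => v _; case: ifP.
rewrite exchange_big /=.
under eq_bigr => v _.
  have : [disjoint [set v] & set0 : {set V}] by rewrite -setI_eq0 setI0.
  move/(subset_law_cylinder p); rewrite cards1 cards0 expr1 mulr1 => h.
  rewrite (eq_bigr (fun B : {set V} => if v \in B then subset_law p B else 0)); last first.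
    by move=> B _; case: ifP; rewrite ?mulr1 ?mulr0.
  rewrite -big_mkcond (eq_bigl (fun B : {set V} => ([set v] \subset B) && [disjoint set0 & B])).
    rewrite h. over.
  by move=> B; rewrite sub1set -setI_eq0 set0I eqxx andbT.
by rewrite sumr_const -[_ *+ _]mulr_natl.
Qed.

Lemma subset_law_pairs_mean (R : realFieldType) (V : finType) (p : R) :
  \sum_(B : {set V}) subset_law p B * (#|B| * (#|B|.-1))%N%:R =
  (#|V| * #|V|.-1)%N%:R * p ^+ 2.
Proof.
transitivity (\sum_(B : {set V}) \sum_u \sum_(v | v != u)
    subset_law p B * ((u \in B) && (v \in B))%:R).
  apply: eq_bigr => B _; under eq_bigr do rewrite -mulr_sumr; rewrite -mulr_sumr.
  under eq_bigr do rewrite -natr_sum; rewrite -natr_sum; congr (_ * _%:R).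
  rewrite (bigID (mem B)) /= [X in (_ + X)%N]big1 ?addn0; last first.
    by move=> u uB; rewrite big1 // => v _; rewrite (negbTE uB).
  rewrite (eq_bigr (fun=> #|B|.-1)) ?sum_nat_const // => u uB.
  rewrite (cardsD1 u B) uB /= -sum1_card big_mkcond [RHS]big_mkcond /=.
  by apply: eq_bigr => v _; rewrite !inE; case: (v != u); case: (v \in B).
rewrite exchange_big /=.
under eq_bigr => u _.
  rewrite exchange_big /=.
  under eq_bigr => v vu.
    have : [disjoint [set u; v] & set0 : {set V}] by rewrite -setI_eq0 setI0.
    move/(subset_law_cylinder p); rewrite cards2 cards0 expr0 mulr1 eq_sym vu => h.
    rewrite (eq_bigr (fun B : {set V} => if (u \in B) && (v \in B) then subset_law p B else 0)); last first.
      by move=> B _; case: ifP; rewrite ?mulr1 ?mulr0.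
    rewrite -big_mkcond (eq_bigl (fun B : {set V} => ([set u; v] \subset B) && [disjoint set0 & B])).
      rewrite h. over.
    by move=> B; rewrite subUset !sub1set -setI_eq0 set0I eqxx andbT.
  rewrite sumr_const cardC1.
  over.
by rewrite sumr_const -!mulrnA -[_ *+ _]mulr_natl mulnC.
Qed.

Lemma subset_law_singletons (R : realFieldType) (V : finType) (p : R) :
  \sum_(B : {set V} | #|B| == 1%N) subset_law p B = #|V|%:R * (p * (1 - p) ^+ (#|V| - 1)).
Proof.
rewrite (eq_bigr (fun=> p * (1 - p) ^+ (#|V| - 1))); last first.
  move=> B /eqP B1; rewrite subset_law_card B1 expr1.
  by rewrite -(cardsC B) B1 addKn.
rewrite sumr_const -[_ *+ _]mulr_natl; congr (_%:R * _).
have := cards_draws [set: V] 1; rewrite cardsT bin1 => <-.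
by apply: eq_card => B; rewrite !inE subsetT.
Qed.

(** Summed over the features, this identifies [S1] as the expected number of slots. *)
Lemma shared_card_mean (R : realFieldType) (V : finType) (p : R) :
  \sum_(B : {set V}) subset_law p B * (shared_card B)%:R =
  #|V|%:R * p * (1 - (1 - p) ^+ (#|V| - 1)).
Proof.
have -> : \sum_(B : {set V}) subset_law p B * (shared_card B)%:R =
    \sum_(B : {set V}) subset_law p B * #|B|%:R - \sum_(B : {set V} | #|B| == 1%N) subset_law p B.
  rewrite [X in _ - X]big_mkcond -sumrB; apply: eq_bigr => B _; rewrite /shared_card.
  by case: (#|B|) => [|[|k]] /=; rewrite ?(mulr0n, mulr1n) ?mulr0 ?mulr1 ?subrr ?subr0.
rewrite subset_law_card_mean subset_law_singletons; ring.
Qed.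

Lemma shared_card_sqr_mean (R : realFieldType) (V : finType) (p : R) :
  \sum_(B : {set V}) subset_law p B * (shared_card B)%:R ^+ 2 =
  #|V|%:R * p * (1 - (1 - p) ^+ (#|V| - 1)) + (#|V| * #|V|.-1)%N%:R * p ^+ 2.
Proof.
rewrite -shared_card_mean -subset_law_pairs_mean -big_split /=.
apply: eq_bigr => B _; rewrite -mulrDr -natrX -natrD /shared_card; congr (_ * _%:R).
by case: (#|B|) => [|[|k]] /=; rewrite -mulnn ?mulnS.
Qed.

Lemma one_subX_le (R : realFieldType) (p : R) (k : nat) : 0 <= p <= 1 ->
  k%:R * p <= (1 - (1 - p) ^+ k) * (1 + k%:R * p).
Proof.
move=> /andP[p0 p1].
have h : (1 - p) ^+ k * (1 + k%:R * p) <= 1.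
  elim: k => [|k IH]; first by rewrite expr0 mul0r addr0 mulr1.
  apply: le_trans IH; rewrite exprSr -mulrA ler_wpM2l ?exprn_ge0 ?subr_ge0 //.
  have k0 : 0 <= k%:R :> R by [].
  have : 0 <= (k%:R + 1) * p ^+ 2 by rewrite mulr_ge0 ?exprn_ge0 // addr_ge0.
  rewrite -natr1 expr2; lra.
move: h; set x := (1 - p) ^+ k; lra.
Qed.

(** [one_subX_le] expresses the pair moment through the mean itself, so that summation over the
    features gives [S1] times [2 + n * P]. *)
Lemma shared_card_sqr_mean_le (R : realFieldType) (V : finType) (p P : R) :
  0 <= p <= 1 -> p <= P -> 
  \sum_(B : {set V}) subset_law p B * (shared_card B)%:R ^+ 2 <=
  #|V|%:R * p * (1 - (1 - p) ^+ (#|V| - 1)) * (2 + #|V|%:R * P).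
Proof.
move=> /andP[p0 p1] pP; rewrite shared_card_sqr_mean; set n := #|V|.
set q := 1 - (1 - p) ^+ (n - 1).
have q0 : 0 <= q by rewrite subr_ge0 exprn_ile1 ?subr_ge0 // gerBl.
have n0 : 0 <= n%:R :> R by [].
have h := @one_subX_le R p (n - 1) (introT andP (conj p0 p1)).
rewrite -/q in h.
have h2 : (n - 1)%:R * p <= n%:R * P.
  by apply: ler_pM => //; rewrite ler_nat leq_subr.
have -> : n%:R * p * q * (2 + n%:R * P) = n%:R * p * q + n%:R * p * (q * (1 + n%:R * P)) by ring.
rewrite lerD2l -subn1 natrM.
have -> : n%:R * (n - 1)%:R * p ^+ 2 = n%:R * p * ((n - 1)%:R * p) by ring.
rewrite ler_wpM2l ?mulr_ge0 //; apply: le_trans h _.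
by rewrite ler_wpM2l // lerD2l.
Qed.

Definition feature_blocks (I : Type) (i : I) (k : nat) : seq (I * bool) :=
  if (k < 2)%N then [::] else rcons (nseq (k./2).-1 (i, false)) (i, odd k).

Definition family_blocks (V I : finType) (A : {ffun I -> {set V}}) : seq (I * bool) :=
  flatten [seq feature_blocks i #|A i| | i <- enum I].

Lemma feature_blocks_size (I : Type) (i : I) (k : nat) :
  (\sum_(b <- feature_blocks i k) (2 + b.2) = if k < 2 then 0 else k)%N.
Proof.
rewrite /feature_blocks; case: ltnP => k2; first by rewrite big_nil.
rewrite -cats1 big_cat big_seq1 /= big_nseq.
have -> m : iter m (addn (2 + 0)) 0%N = (m * 2)%N by elim: m => //= m ->; rewrite mulSn.
rewrite -[RHS]odd_double_half muln2; case: (k./2) (half_leq k2) => // m _.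
by rewrite doubleS; lia.
Qed.

Lemma family_blocks_total (V I : finType) (A : {ffun I -> {set V}}) :
  (\sum_(b <- family_blocks A) (2 + b.2) = \sum_i shared_card (A i))%N.
Proof.
rewrite /family_blocks big_flatten big_map big_enum /=.
by apply: eq_bigr => i _; rewrite feature_blocks_size.
Qed.

Lemma family_blocks_feature (V I : finType) (A : {ffun I -> {set V}}) i :
  (\sum_(b <- family_blocks A | b.1 == i) (2 + b.2) <= #|A i|)%N.
Proof.
rewrite /family_blocks big_flatten big_map big_enum /= (bigD1 i) //= [X in (_ + X)%N]big1 ?addn0.
  apply: (@leq_trans (\sum_(b <- feature_blocks i #|A i|) (2 + b.2))).
    by rewrite [leqRHS](bigID (fun b => b.1 == i)) leq_addr.
  by rewrite feature_blocks_size; case: ifP.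
move=> j ji; rewrite /feature_blocks; case: ifP => _; first by rewrite big_nil.
rewrite big_seq_cond big1 // => b /andP[].
by rewrite mem_rcons inE mem_nseq => /orP[/eqP -> /= /eqP ij|/andP[_ /eqP ->] /= /eqP ij]; move: ji; rewrite ij eqxx.
Qed.

Lemma family_graph_mono (V I : finType) (A1 A2 : {ffun I -> {set V}}) :
  (forall i, A1 i \subset A2 i) -> subrel (family_graph A1) (family_graph A2).
Proof.
move=> h u v /andP[uv /existsP[i /andP[ui vi]]]; rewrite /family_graph uv /=.
by apply/existsP; exists i; rewrite !(subsetP (h i)).
Qed.

Lemma block_graph_family (V I : finType) (bl : seq (I * bool)) (l : seq (V * V * V)) :
  size l = size bl ->
  subrel (block_graph (blocks [seq b.2 | b <- bl] l)) (family_graph (block_family bl l)).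
Proof.
move=> sl u v /andP[uv /hasP[c]]; rewrite /family_graph uv /= /blocks => /mapP[t].
have -> : zip [seq b.2 | b <- bl] l = [seq (x.1.2, x.2) | x <- zip bl l].
  by elim: (bl) (l) sl => [|b bl' IH] [|y l'] //= [/IH ->].
move=> /mapP[x xz ->] -> /= /andP[uc vc].
apply/existsP; exists x.1.1; rewrite !ffunE !inE.
by apply/andP; split; apply/hasP; exists x => //; rewrite eqxx.
Qed.

(** Given the sizes of the features, the list of blocks is fixed and its entries are uniform; [H]
    then applies as soon as there are [T] slots, and [lower_tail] bounds the probability of
    fewer. *)
Lemma nonhamiltonian_prob_le (R : realType) (V I : finType) (p : I -> R) (P eps T : R) :
  (0 < #|V|)%N -> 0 <= eps -> (forall i, 0 <= p i <= P) -> P <= 1 ->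
  (forall bl : seq bool, T <= (\sum_(b <- bl) (2 + b))%N%:R ->
     avgl (size bl) (fun l => (~~ has_hamilton_cycle (block_graph (blocks bl l) : rel V))%:R) <= eps) ->
  let mu := \sum_i #|V|%:R * p i * (1 - (1 - p i) ^+ (#|V| - 1)) in
  0 < mu -> T <= mu ->
  \sum_(A : {ffun I -> {set V}}) family_law p A * (~~ has_hamilton_cycle (family_graph A))%:R <=
  eps + expR (- ((mu - T) ^+ 2 / (4 * (mu * (2 + #|V|%:R * P))))).
Proof.
move=> V0 e0 pP P1 H mu mu0 Tmu.
have p01 i : 0 <= p i <= 1 by have /andP[-> /le_trans ->] := pP i.
have P0 : 0 < 2 + #|V|%:R * P.
  case: (pickP (fun i : I => true)) => [i _|I0].
    have /andP[h1 h2] := pP i; have : 0 <= #|V|%:R * P by rewrite mulr_ge0 // (le_trans h1).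
    lra.
  by move: mu0; rewrite /mu big_pred0 ?ltxx.
pose g (A : {ffun I -> {set V}}) : R := (~~ has_hamilton_cycle (family_graph A))%:R.
have gm (A1 A2 : {ffun I -> {set V}}) : (forall i, A1 i \subset A2 i) -> g A2 <= g A1.
  move=> h; rewrite ler_nat; have := has_hamilton_cycle_sub (family_graph_mono h).
  by case: (has_hamilton_cycle (family_graph A1)) => [->|] //; case: has_hamilton_cycle.
rewrite (family_expectation_symm p g).
apply: (@le_trans _ _ (\sum_(A : {ffun I -> {set V}}) (family_law p A * eps +
   (if \sum_i (shared_card (A i))%:R < T then family_law p A else 0)))).
  apply: ler_sum => A _.
  have l0 := family_law_ge0 A p01.
  case: ltP => hT.
    apply: (@le_trans _ _ (family_law p A * 1)).
      apply: ler_wpM2l => //.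
      rewrite -[leRHS](avg_cst (T := {ffun I -> {perm V}})); last by apply/card_gt0P; exists [ffun=> 1%g].
      by apply: avg_le => s; rewrite lern1 leq_b1.
    by rewrite mulr1 lerDr mulr_ge0.
  rewrite addr0 ler_wpM2l //.
  apply: le_trans (coupling V0 gm (family_blocks_feature A)) _.
  apply: (@le_trans _ _ (avgl (size [seq b.2 | b <- family_blocks A])
     (fun l => (~~ has_hamilton_cycle (block_graph (blocks [seq b.2 | b <- family_blocks A] l) : rel V))%:R))).
    rewrite size_map; apply: avgl_le => l sl; rewrite ler_nat.
    have := has_hamilton_cycle_sub (block_graph_family sl).
    by case: (has_hamilton_cycle (block_graph _)) => [->|] //; case: has_hamilton_cycle.
  by apply: H; rewrite big_map family_blocks_total natr_sum.
rewrite big_split /= -mulr_suml family_law_sum1 mul1r lerD2l -big_mkcond /=.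
have muE : mu = \sum_i \sum_(B : {set V}) subset_law (p i) B * (shared_card B)%:R.
  by apply: eq_bigr => i _; rewrite shared_card_mean.
have n0 : 0 < #|V|%:R :> R by rewrite ltr0n.
apply: (@lower_tail R I {set V} (fun i B => subset_law (p i) B) (fun i B => (shared_card B)%:R)) => //.
- by move=> i B; apply: subset_law_ge0.
- by move=> i; apply: subset_law_sum1.
- rewrite /mu mulr_suml; apply: ler_sum => i _.
  by apply: shared_card_sqr_mean_le => //; case/andP: (pP i).
by rewrite mulr_gt0.
Qed.

(** * Vertices of degree at most one *)

Lemma rig_prob_family (R : realType) (n m : nat) (p : 'I_m -> R) (Q : pred (rel 'I_n)) :
  rig_prob n p Q =
  \sum_(A : {ffun 'I_m -> {set 'I_n}}) family_law p A * (Q (family_graph A))%:R.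
Proof.
pose h (W : {ffun 'I_n -> {set 'I_m}}) : {ffun 'I_m -> {set 'I_n}} :=
  [ffun i => [set v | i \in W v]].
pose h' (A : {ffun 'I_m -> {set 'I_n}}) : {ffun 'I_n -> {set 'I_m}} :=
  [ffun v => [set i | v \in A i]].
have hK : cancel h h' by move=> W; apply/ffunP => v; apply/setP => i; rewrite !(ffunE, inE).
have h'K : cancel h' h by move=> A; apply/ffunP => i; apply/setP => v; rewrite !(ffunE, inE).
rewrite /rig_prob [RHS](reindex h) /=; last by exists h' => ? _.
rewrite big_mkcond; apply: eq_bigr => W _.
have -> : family_graph (h W) = intersection_graph W.
  apply/funext => u; apply/funext => v; rewrite /family_graph /intersection_graph /=.
  congr (_ && _); apply/existsP/set0Pn => -[i]; first by rewrite ffunE !inE => ?; exists i; rewrite inE.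
  by rewrite inE => ?; exists i; rewrite ffunE !inE.
have -> : family_law p (h W) = feature_weight p W.
  rewrite /family_law /subset_law /feature_weight exchange_big /=.
  by apply: eq_bigr => v _; apply: eq_bigr => i _; rewrite ffunE inE.
by case: ifP; rewrite ?mulr1 ?mulr0.
Qed.

Lemma hamilton_two_neighbors (V : finType) (e : rel V) (v : V) :
  symmetric e -> has_hamilton_cycle e ->
  exists x y, [/\ x != y, x != v, y != v, e v x & e v y].
Proof.
move=> eC /andP[V3 /existsP[s /andP[cs us]]].
have vs : v \in s.
  have : s =i predT by apply/subset_cardP; rewrite ?subset_predT // (card_uniqP us) size_tuple.
  by move=> ->.
have [k t rs] := rot_to vs.
have st : (3 <= size (v :: t))%N by rewrite -rs size_rot size_tuple.
move: cs us; rewrite -(rot_cycle k) -(rot_uniq k) rs.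
case: t st rs => [|x t] //; case/lastP: t => [|t y] // _ _.
rewrite /= => /andP[evx]; rewrite rcons_path last_rcons => /andP[_ eyv].
move=> /and3P[]; rewrite !inE !mem_rcons !inE !negb_or => /and3P[vx vy _] /andP[xy _] _.
by exists x, y; rewrite xy evx eC eyv (eq_sym x) (eq_sym y).
Qed.

Definition alone_in (V : finType) (v : V) (B : {set V}) : bool :=
  (v \notin B) || (B == [set v]).

Definition paired_in (V : finType) (v : V) (B : {set V}) : bool :=
  (v \in B) && (#|B| == 2%N).

(* [o = None]: every feature is useless to [v]; [o = Some i]: only feature [i] serves [v],
   and it gives [v] a single neighbour. *)
Definition low_degree (V I : finType) (v : V) (o : option I) (A : {ffun I -> {set V}}) : bool :=
  [forall i, if o == Some i then paired_in v (A i) else alone_in v (A i)].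

(** The two neighbours on a Hamilton cycle would both have to come from the one feature [o], which
    has no room for a third vertex. *)
Lemma low_degree_nonhamiltonian (V I : finType) (v : V) (o : option I) (A : {ffun I -> {set V}}) :
  low_degree v o A -> ~~ has_hamilton_cycle (family_graph A).
Proof.
move=> /forallP low; apply/negP => ham.
have gC : symmetric (family_graph A).
  move=> a b; rewrite /family_graph eq_sym; congr andb.
  by apply: eq_existsb => i; rewrite andbC.
have [x [y [xy xv yv /andP[_ /existsP[i /andP[vi xi]]] /andP[_ /existsP[j /andP[vj yj]]]]]] :=
  hamilton_two_neighbors v gC ham.
have key k z : z != v -> v \in A k -> z \in A k -> o = Some k /\ #|A k| = 2%N.
  move=> zv vk zk; have := low k; case: eqP => [-> /andP[_ /eqP ->]//|_].
  rewrite /alone_in vk /= => /eqP Ak; move: zk; rewrite Ak inE => /eqP zE.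
  by rewrite zE eqxx in zv.
have [oi ci] := key i x xv vi xi; have [oj _] := key j y yv vj yj.
move: oj; rewrite oi => -[ij]; rewrite -ij in yj.
have : (#|[set v; x; y]| <= #|A i|)%N.
  by apply/subset_leq_card/subsetP => z; rewrite !inE => /orP[/orP[]|] /eqP ->.
rewrite ci cardsU cards2 cards1 (eq_sym v) xv.
have -> : [set v; x] :&: [set y] = set0.
  apply/setP => z; rewrite !inE; apply/negP => /andP[/orP[]/eqP -> /eqP h].
    by rewrite h eqxx in yv.
  by rewrite h eqxx in xy.
by rewrite cards0.
Qed.

(** Disjointness over [o] lets the diagonal of the second moment collapse to the first moment. *)
Lemma low_degree_unique (V I : finType) (v : V) (o o' : option I) (A : {ffun I -> {set V}}) :
  low_degree v o A -> low_degree v o' A -> o = o'.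
Proof.
have aux (i : I) (a b : option I) : a = Some i -> low_degree v a A -> low_degree v b A -> b = Some i.
  move=> aE /forallP/(_ i) + /forallP/(_ i); rewrite aE eqxx => /andP[vi /eqP c2].
  case: eqP => // _; rewrite /alone_in vi => /eqP h; move: c2; by rewrite h cards1.
move=> h h'; case oE : o => [i|].
  by rewrite (aux i o o' oE h h').
case oE' : o' => [i|] //; by have := aux i o' o oE' h' h; rewrite oE.
Qed.

(** * Probabilities for one feature and one or two given vertices *)

Section Moments.
Variables (R : realFieldType) (V : finType) (p : R).
Hypothesis p01 : 0 <= p <= 1.
Let n := #|V|.
Local Notation ex F := (\sum_(B : {set V}) subset_law p B * (F B)%:R).

Let law0 (B : {set V}) : 0 <= subset_law p B.
Proof. exact: subset_law_ge0. Qed.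

Lemma sum_law_eq (D : {set V}) : ex (fun B => B == D) = p ^+ #|D| * (1 - p) ^+ (n - #|D|).
Proof.
rewrite (bigD1 D) //= eqxx mulr1 big1 ?addr0 => [|B /negbTE ->]; last by rewrite mulr0.
by rewrite subset_law_card /n -(cardsC D) addKn.
Qed.

Lemma sum_law_avoid (D : {set V}) : ex (fun B => [disjoint D & B]) = (1 - p) ^+ #|D|.
Proof.
have : [disjoint set0 & D] by rewrite -setI_eq0 set0I.
move/(subset_law_cylinder p); rewrite cards0 mul1r => <-.
rewrite [RHS]big_mkcond; apply: eq_bigr => B _; rewrite sub0set /=.
by case: ifP; rewrite ?mulr1 ?mulr0.
Qed.

Lemma alone_mean (v : V) : (0 < n)%N ->
  ex (alone_in v) = 1 - p * (1 - (1 - p) ^+ (n - 1)).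
Proof.
move=> n0.
transitivity (ex (fun B => [disjoint [set v] & B]) + ex (fun B => B == [set v])).
  rewrite -big_split /=; apply: eq_bigr => B _; rewrite -mulrDr -natrD; congr (_ * _%:R).
  rewrite /alone_in disjoints1; case: (boolP (B == [set v])) => [/eqP ->|_].
    by rewrite inE eqxx.
  by rewrite orbF addn0.
rewrite sum_law_avoid sum_law_eq !cards1 !expr1; ring.
Qed.

Lemma paired_mean (v : V) : (2 <= n)%N ->
  ex (paired_in v) = (n - 1)%:R * (p ^+ 2 * (1 - p) ^+ (n - 2)).
Proof.
move=> n2.
transitivity (\sum_(B : {set V} | B \in [set [set v; w] | w in [set~ v]]) p ^+ 2 * (1 - p) ^+ (n - 2)).
  rewrite [RHS]big_mkcond; apply: eq_bigr => B _.
  have -> : (B \in [set [set v; w] | w in [set~ v]]) = paired_in v B.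
    apply/imsetP/idP => [[w]|/andP[vB /eqP B2]].
      by rewrite !inE => wv ->; rewrite /paired_in !inE eqxx cards2 eq_sym wv.
    have /cards1P[w Bw] : #|B :\ v| == 1%N.
      by have := cardsD1 v B; rewrite vB B2 => /eqP; rewrite eq_sym.
    exists w; last by rewrite -(setD1K vB) Bw.
    have : w \in B :\ v by rewrite Bw inE.
    by rewrite !inE => /andP[].
  case: ifP => [/andP[_ /eqP B2]|]; last by rewrite mulr0.
  by rewrite mulr1 subset_law_card /n -(cardsC B) B2 addKn.
rewrite sumr_const.
have -> : #|[set [set v; w] | w in [set~ v]]| = (n - 1)%N.
  rewrite card_in_imset; first by rewrite cardsC1 subn1.
  move=> w w'; rewrite !inE => wv wv' /setP/(_ w); rewrite !inE eqxx orbT (negbTE wv) /=.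
  by move/esym/eqP.
by rewrite -[LHS]mulr_natl.
Qed.

Lemma alone_alone_mean (u v : V) : (0 < n)%N -> u != v ->
  ex (fun B => alone_in u B && alone_in v B) <=
  (1 - p) ^+ 2 + 2 * (p * (1 - p) ^+ (n - 1)).
Proof.
move=> n0 uv.
apply: (@le_trans _ _ (ex (fun B => [disjoint [set u; v] & B]) +
   (ex (fun B => B == [set u]) + ex (fun B => B == [set v])))).
  rewrite -!big_split /=; apply: ler_sum => B _; rewrite -!mulrDr -!natrD ler_wpM2l // ler_nat.
  have -> : [disjoint [set u; v] & B] = (u \notin B) && (v \notin B).
    rewrite -setI_eq0 setIUl setU_eq0 !setI_eq0; congr (_ && _); exact: disjoints1.
  rewrite /alone_in.
  by case: (B == [set u]); case: (B == [set v]); case: (u \in B); case: (v \in B).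
rewrite sum_law_avoid !sum_law_eq !cards1 cards2 uv !expr1; lra.
Qed.

Lemma paired_paired_mean (u v : V) : u != v ->
  ex (fun B => paired_in u B && paired_in v B) <= p ^+ 2 * (1 - p) ^+ (n - 2).
Proof.
move=> uv; apply: (@le_trans _ _ (ex (fun B => B == [set u; v]))); last first.
  by rewrite sum_law_eq cards2 uv.
apply: ler_sum => B _; rewrite ler_wpM2l // ler_nat.
case: (boolP (_ && _)) => // /andP[/andP[uB /eqP B2] /andP[vB _]].
by rewrite eq_sym eqEcard subUset !sub1set uB vB B2 cards2 uv.
Qed.

Lemma ex_le (F G : {set V} -> bool) : (forall B, F B -> G B) -> ex F <= ex G.
Proof.
move=> FG; apply: ler_sum => B _; rewrite ler_wpM2l // ler_nat.
by case FB : (F B) => //; rewrite FG.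
Qed.

End Moments.

(** Chebyshev's inequality in direct form: [(1 - Y / m) ^+ 2] is 1 on [Q] and nonnegative
    elsewhere. *)
Lemma second_moment (R : realFieldType) (T : finType) (w Y : T -> R) (Q : pred T) :
  (forall x, 0 <= w x) -> \sum_x w x = 1 -> (forall x, Q x -> Y x = 0) ->
  0 < \sum_x w x * Y x ->
  \sum_x w x * (Q x)%:R <= (\sum_x w x * Y x ^+ 2) / (\sum_x w x * Y x) ^+ 2 - 1.
Proof.
move=> w0 w1 QY; set m := \sum_x w x * Y x => m0.
apply: (@le_trans _ _ (\sum_x w x * (1 - Y x / m) ^+ 2)).
  apply: ler_sum => x _; rewrite ler_wpM2l //; case: (boolP (Q x)) => [/QY ->|_].
    by rewrite mul0r subr0 expr1n.
  exact: sqr_ge0.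
have -> : \sum_x w x * (1 - Y x / m) ^+ 2 =
    \sum_x w x + (- 2 / m) * (\sum_x w x * Y x) + (m ^+ 2)^-1 * (\sum_x w x * Y x ^+ 2).
  rewrite !mulr_sumr -!big_split /=; apply: eq_bigr => x _; field.
  by rewrite lt0r_neq0.
rewrite -/m w1 le_eqVlt; apply/orP; left; apply/eqP; field.
by rewrite lt0r_neq0.
Qed.

Lemma sum_option (R : nmodType) (I : finType) (F : option I -> R) :
  \sum_o F o = F None + \sum_i F (Some i).
Proof.
rewrite (bigD1 None) //=; congr (_ + _).
rewrite (reindex_omap Some id) /=; last by case.
by apply: eq_bigl => i; rewrite eqxx.
Qed.

Lemma prod_single (R : realFieldType) (I : finType) (i : I) (F : I -> R) :
  (forall k, k != i -> F k = 1) -> \prod_k F k = F i.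
Proof. by move=> h; rewrite (bigD1 i) //= big1 ?mulr1. Qed.

Section Pairs.
Variables (R : realFieldType) (V I : finType) (p : I -> R) (P : R).
Hypothesis pP : forall i, 0 <= p i <= P.
Hypothesis P4 : P <= 1 / 4.
Hypothesis P0 : 0 <= P.
Hypothesis V3 : (3 <= #|V|)%N.
Let n := #|V|.
(** For a fixed vertex, [d i] and [r i] are the probabilities of [alone_in] and [paired_in]; [rho i]
    is that of feature [i] being held by exactly two given vertices. Hence [\sum_i (1 - d i)] is
    [S1 / n] and [\sum_i r i] is [S12 / n]. The constant [ka] bounds [(d i ^+ 2)^-1]. *)
Let d i : R := 1 - p i * (1 - (1 - p i) ^+ (n - 1)).
Let rho i : R := p i ^+ 2 * (1 - p i) ^+ (n - 2).
Let r i : R := (n - 1)%:R * rho i.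
Let ka : R := ((1 - P) ^+ 2)^-1.
Local Notation low v o A := (@low_degree V I v o A)%:R.

Let p01 i : 0 <= p i <= 1.
Proof. by have /andP[-> h] := pP i; apply: le_trans h _; move: P4; lra. Qed.

Let e (i : I) (b : bool) (v : V) (B : {set V}) : bool :=
  if b then paired_in v B else alone_in v B.

Let lowE v o A : low v o A = ( \prod_i (e i (o == Some i) v (A i))%:R : R).
Proof.
rewrite /low_degree; case: (boolP [forall i, _]) => [/forallP h|].
  by rewrite big1 // => i _; have := h i; rewrite /e; case: eqP => _ ->.
rewrite negb_forall => /existsP[i h]; rewrite (bigD1 i) //=.
by move: h; rewrite /e; case: eqP => _ /negbTE ->; rewrite mul0r.
Qed.

Let rho_ge0 i : 0 <= rho i.
Proof. by have /andP[h1 h2] := p01 i; rewrite mulr_ge0 ?exprn_ge0 ?subr_ge0. Qed.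

Let r_ge0 i : 0 <= r i.
Proof. by rewrite mulr_ge0. Qed.

Let d_le1 i : d i <= 1.
Proof.
have /andP[h1 h2] := p01 i; rewrite gerBl mulr_ge0 // subr_ge0 exprn_ile1 ?subr_ge0 //.
by rewrite gerBl.
Qed.

Let d_ge i : 1 - P <= d i.
Proof.
have /andP[h1 h2] := p01 i; have /andP[_ h3] := pP i.
have : 0 <= p i * (1 - p i) ^+ (n - 1) by rewrite mulr_ge0 // exprn_ge0 // subr_ge0.
rewrite /d; lra.
Qed.

Let d_gt0 i : 0 < d i.
Proof. by apply: lt_le_trans (d_ge i); move: P4; lra. Qed.

Let D_gt0 : 0 < \prod_i d i.
Proof. exact: prodr_gt0. Qed.

Let low_mean v o :
  \sum_A family_law p A * low v o A = \prod_i (if o == Some i then r i else d i).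
Proof.
rewrite (eq_bigr (fun A => family_law p A * \prod_i (e i (o == Some i) v (A i))%:R)); last first.
  by move=> A _; rewrite lowE.
rewrite (family_expectation_prod p (fun i B => (e i (o == Some i) v B)%:R)).
apply: eq_bigr => i _; rewrite /e; case: ifP => _.
  by rewrite paired_mean // ltnW.
by rewrite alone_mean // ltnW // ltnW.
Qed.

Let low_sum_ge : \prod_i d i * (1 + \sum_i r i) <=
  \sum_o \prod_i (if o == Some i then r i else d i).
Proof.
rewrite sum_option /= mulrDr mulr1 mulr_sumr lerD //.
apply: ler_sum => i _.
have -> : \prod_k (if Some i == Some k then r k else d k) = r i * \prod_(k | k != i) d k.
  rewrite (bigD1 i) //= eqxx; congr (_ * _); apply: eq_bigr => k /negbTE ki.
  by rewrite -[Some i == Some k]/(i == k) eq_sym ki.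
rewrite (bigD1 i) //= mulrC mulrCA ler_piMl // mulr_ge0 // ltW // prodr_gt0 //.
Qed.

(** Bound for the joint probability at two vertices relative to [d i ^+ 2 * (1 + 4 * rho i)]. After
    this common factor is split off, at most two factors of a product over the features differ from
    1. *)
Let pair_weight i (a b : bool) : R :=
  if a then (if b then ka * rho i else ka * r i) else if b then ka * r i else 1.

Let ka_d i : 1 <= d i ^+ 2 * ka.
Proof.
have P1 : 0 < 1 - P by move: P4; lra.
rewrite -ler_pdivrMr ?invr_gt0 ?exprn_gt0 // invrK mul1r.
by rewrite lerXn2r ?nnegrE ?(ltW P1) ?(ltW (d_gt0 i)).
Qed.

Let pair_mean_le u v i (a b : bool) : u != v ->
  \sum_(B : {set V}) subset_law (p i) B * ((e i a u B)%:R * (e i b v B)%:R) <=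
  d i ^+ 2 * (1 + 4 * rho i) * pair_weight i a b.
Proof.
move=> uv.
under eq_bigr => B _ do rewrite -natrM mulnb.
have /andP[h1 h2] := p01 i; have /andP[_ h3] := pP i.
have n1 : (0 < n)%N by rewrite ltnW // ltnW.
have n2 : (2 <= n)%N by rewrite ltnW.
have big x : 0 <= x -> x <= d i ^+ 2 * (1 + 4 * rho i) * (ka * x).
  move=> x0.
  have -> : d i ^+ 2 * (1 + 4 * rho i) * (ka * x) = (d i ^+ 2 * ka) * ((1 + 4 * rho i) * x) by ring.
  apply: (@le_trans _ _ ((1 + 4 * rho i) * x)).
    by rewrite ler_peMl // lerDl mulr_ge0.
  apply: ler_peMl; last exact: ka_d.
  by apply: mulr_ge0 => //; apply: addr_ge0 => //; apply: mulr_ge0.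
rewrite /pair_weight /e; case: a; case: b.
- apply: le_trans (paired_paired_mean (p01 i) uv) _; exact: (big _ (rho_ge0 i)).
- apply: le_trans (big _ (r_ge0 i)); rewrite /r /rho -(paired_mean (p i) u n2).
  by apply: (ex_le (p01 i)) => B /andP[].
- apply: le_trans (big _ (r_ge0 i)); rewrite /r /rho -(paired_mean (p i) v n2).
  by apply: (ex_le (p01 i)) => B /andP[].
rewrite mulr1; apply: le_trans (alone_alone_mean (p01 i) n1 uv) _.
(* The joint bound exceeds [d i ^+ 2] by at most [2 * p i * g <= 2 * rho i], and [1 / 2 <= d i ^+ 2]
   turns this into the relative error [4 * rho i]. *)
set g := p i * (1 - p i) ^+ (n - 1).
have dE : d i = 1 - p i + g by rewrite /d /g; ring.
have pg : p i * g <= rho i.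
  have -> : p i * g = rho i * (1 - p i).
    rewrite /g /rho; have -> : (n - 1 = (n - 2).+1)%N by rewrite subn1 subn2; case: (n) n2 => [|[|k]].
    by rewrite exprSr; ring.
  by rewrite ler_piMr // gerBl.
have d2 : 1 / 2 <= d i ^+ 2.
  have h34 : 3 / 4 <= d i by apply: le_trans (d_ge i); move: P4; lra.
  have : (3 / 4) * (3 / 4) <= d i * d i by apply: ler_pM => //; lra.
  rewrite expr2; lra.
have rd : rho i * (1 / 2) <= rho i * d i ^+ 2 by rewrite ler_wpM2l.
have -> : d i ^+ 2 * (1 + 4 * rho i) = d i ^+ 2 + 4 * (rho i * d i ^+ 2) by ring.
have : 0 <= g ^+ 2 by exact: sqr_ge0.
have -> : (1 - p i) ^+ 2 + 2 * g = d i ^+ 2 + 2 * (p i * g) - g ^+ 2 by rewrite dE; ring.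
lra.
Qed.

(** The square is the independent part. The additional [\sum_i rho i] belongs to two vertices that
    are paired with each other in the same feature. *)
Let pair_sum_le :
  \sum_(o : option I) \sum_(o' : option I) \prod_i pair_weight i (o == Some i) (o' == Some i) <=
  (1 + ka * \sum_i r i) ^+ 2 + ka * \sum_i rho i.
Proof.
have ka0 : 0 <= ka by rewrite invr_ge0 sqr_ge0.
rewrite sum_option sum_option /= [X in X + _ + _]big1; last by [].
have single i : \prod_k pair_weight k (Some i == Some k) false = ka * r i.
  rewrite (prod_single (i := i)) ?eqxx // => k /negbTE ki.
  by rewrite -[Some i == Some k]/(i == k) eq_sym ki.
have single' i : \prod_k pair_weight k false (Some i == Some k) = ka * r i.
  rewrite (prod_single (i := i)) ?eqxx // => k /negbTE ki.
  by rewrite -[Some i == Some k]/(i == k) eq_sym ki.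
under eq_bigr do rewrite single'.
have two i j : \prod_k pair_weight k (Some i == Some k) (Some j == Some k) <=
    ka * r i * (ka * r j) + (if j == i then ka * rho i else 0).
  have [->|ji] := eqVneq j i.
    have kr : 0 <= ka * r i by apply: mulr_ge0.
    rewrite (prod_single (i := i)); first by rewrite !eqxx lerDr; apply: mulr_ge0.
    move=> k /negbTE ki.
    by rewrite -[Some i == Some k]/(i == k) eq_sym ki.
  rewrite addr0 (bigD1 i) //= (bigD1 j) //= big1 ?mulr1; last first.
    move=> k /andP[/negbTE ki /negbTE kj].
    by rewrite -[Some i == Some k]/(i == k) -[Some j == Some k]/(j == k) !(eq_sym _ k) ki kj.
  by rewrite !eqxx -[Some j == Some i]/(j == i) -[Some i == Some j]/(i == j) (eq_sym i) (negbTE ji).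
have h : \sum_i \sum_(o' : option I) \prod_k pair_weight k (Some i == Some k) (o' == Some k) <=
   \sum_i (ka * r i + (ka * r i * (ka * \sum_j r j) + ka * rho i)).
  apply: ler_sum => i _; rewrite sum_option single lerD2l.
  apply: (@le_trans _ _ (\sum_j (ka * r i * (ka * r j) + (if j == i then ka * rho i else 0)))).
    by apply: ler_sum => j _.
  by rewrite big_split /= -!mulr_sumr -big_mkcond big_pred1_eq.
apply: le_trans (lerD (lexx _) h) _.
rewrite !big_split /= -mulr_suml -!mulr_sumr le_eqVlt; apply/orP; left; apply/eqP; ring.
Qed.

(** [Y] counts the vertices with some [low_degree] event. The diagonal contributes the inverse of
    its mean; off the diagonal the factors [D ^+ 2 * (1 + Rr) ^+ 2] cancel and leave a ratio close
    to 1 for small [P]. *)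
Lemma low_degree_second_moment :
  \sum_(A : {ffun I -> {set V}}) family_law p A * (has_hamilton_cycle (family_graph A))%:R <=
  (n%:R * (\prod_i d i * (1 + \sum_i r i)))^-1 +
  \prod_i (1 + 4 * rho i) * (ka ^+ 2 + ka / (n - 1)%:R) - 1.
Proof.
pose Y (A : {ffun I -> {set V}}) : R := \sum_v \sum_o low v o A.
pose s := \sum_(o : option I) \prod_i (if o == Some i then r i else d i).
have n0 : 0 < n%:R :> R by rewrite ltr0n ltnW // ltnW.
have n1 : 0 < (n - 1)%:R :> R by rewrite ltr0n subn_gt0 ltnW.
have Rr0 : 0 <= \sum_i r i by rewrite sumr_ge0.
have ka0 : 0 <= ka by rewrite invr_ge0 sqr_ge0.
have P1 : 0 < 1 - P by move: P4; lra.
have H0 : 0 <= \prod_i (1 + 4 * rho i) by apply: prodr_ge0 => i _; rewrite addr_ge0 // mulr_ge0.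
set D := \prod_i d i; set Rr := \sum_i r i; rewrite -/Rr in Rr0.
have s_ge : D * (1 + Rr) <= s := low_sum_ge.
have DR0 : 0 < D * (1 + Rr) by rewrite mulr_gt0 //; move: Rr0; lra.
have s0 : 0 < s by apply: lt_le_trans s_ge.
have YE : \sum_A family_law p A * Y A = n%:R * s.
  under eq_bigr do rewrite mulr_sumr.
  rewrite exchange_big /= (eq_bigr (fun=> s)); first by rewrite sumr_const -[LHS]mulr_natl.
  move=> v _; under eq_bigr do rewrite mulr_sumr.
  by rewrite exchange_big /=; apply: eq_bigr => o _; rewrite low_mean.
pose X := (1 + ka * Rr) ^+ 2 + ka * \sum_i rho i.
pose W := D ^+ 2 * \prod_i (1 + 4 * rho i) * X.
pose T u v A : R := \sum_o \sum_o' low u o A * low v o' A.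
have TE u v : \sum_A family_law p A * T u v A =
    \sum_o \sum_o' \sum_A family_law p A * (low u o A * low v o' A).
  under eq_bigr do rewrite mulr_sumr.
  rewrite exchange_big /=; apply: eq_bigr => o _.
  under eq_bigr do rewrite mulr_sumr.
  by rewrite exchange_big.
have T_diag u : \sum_A family_law p A * T u u A = s.
  rewrite TE; apply: eq_bigr => o _; rewrite (bigD1 o) //= [X in _ + X]big1 ?addr0.
    rewrite -(low_mean u); apply: eq_bigr => A _; congr (_ * _).
    by case: low_degree; rewrite ?mulr1 ?mulr0.
  move=> o' oo'; rewrite big1 // => A _.
  case h : (low_degree u o A); last by rewrite mul0r mulr0.
  case h' : (low_degree u o' A); last by rewrite !mulr0.
  by move: oo'; rewrite (low_degree_unique h h') eqxx.
have T_off u v : u != v -> \sum_A family_law p A * T u v A <= W.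
  move=> uv; rewrite TE /W.
  apply: (@le_trans _ _ (D ^+ 2 * \prod_i (1 + 4 * rho i) *
     \sum_(o : option I) \sum_(o' : option I) \prod_i pair_weight i (o == Some i) (o' == Some i))); last first.
    by apply: ler_wpM2l => //; apply: mulr_ge0 => //; exact: sqr_ge0.
  rewrite mulr_sumr; apply: ler_sum => o _; rewrite mulr_sumr; apply: ler_sum => o' _.
  rewrite (eq_bigr (fun A : {ffun I -> {set V}} => family_law p A *
      \prod_i ((e i (o == Some i) u (A i))%:R * (e i (o' == Some i) v (A i))%:R))); last first.
    by move=> A _; rewrite !lowE -big_split.
  rewrite (family_expectation_prod p (fun i B => (e i (o == Some i) u B)%:R * (e i (o' == Some i) v B)%:R)).
  have pw0 i a b : 0 <= pair_weight i a b.
    by rewrite /pair_weight; case: a; case: b => //; apply: mulr_ge0.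
  apply: (@le_trans _ _ (\prod_i (d i ^+ 2 * (1 + 4 * rho i) * pair_weight i (o == Some i) (o' == Some i)))).
    apply: ler_prod => i _; rewrite pair_mean_le // andbT; apply: sumr_ge0 => B _.
    by rewrite mulr_ge0 ?subset_law_ge0 // mulr_ge0.
  by rewrite 2!big_split /= prodrXl.
have X0 : 0 <= X by rewrite addr_ge0 ?sqr_ge0 // mulr_ge0 // sumr_ge0.
have DH0 : 0 <= D ^+ 2 * \prod_i (1 + 4 * rho i) by apply: mulr_ge0 => //; exact: sqr_ge0.
have W0 : 0 <= W by apply: mulr_ge0.
have Y2E : \sum_A family_law p A * Y A ^+ 2 <= n%:R * (s + n%:R * W).
  have -> : \sum_A family_law p A * Y A ^+ 2 = \sum_u \sum_v \sum_A family_law p A * T u v A.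
    have YT A : Y A ^+ 2 = \sum_u \sum_v T u v A.
      rewrite expr2 /Y mulr_suml; apply: eq_bigr => u _.
      rewrite mulr_sumr; apply: eq_bigr => v _; rewrite mulr_suml.
      by apply: eq_bigr => o _; rewrite mulr_sumr.
    under eq_bigr do rewrite YT mulr_sumr.
    rewrite exchange_big /=; apply: eq_bigr => u _.
    under eq_bigr do rewrite mulr_sumr.
    by rewrite exchange_big.
  rewrite mulr_natl -sumr_const; apply: ler_sum => u _.
  rewrite (bigD1 u) //= T_diag lerD2l mulr_natl -sumr_const.
  rewrite [leRHS](bigID (fun v => v != u)) /= -[leLHS]addr0; apply: lerD; last exact: sumr_ge0.
  by apply: ler_sum => v vu; apply: T_off; rewrite eq_sym.
have QY A : has_hamilton_cycle (family_graph A) -> Y A = 0.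
  move=> ham; rewrite /Y big1 // => v _; rewrite big1 // => o _.
  by case h : (low_degree v o A) => //; move: (low_degree_nonhamiltonian h); rewrite ham.
have Y0 : 0 < \sum_A family_law p A * Y A by rewrite YE mulr_gt0.
have l0 (A : {ffun I -> {set V}}) : 0 <= family_law p A by apply: family_law_ge0.
have := @second_moment R _ (fun A : {ffun I -> {set V}} => family_law p A) Y (fun A => has_hamilton_cycle (family_graph A)) l0 (family_law_sum1 V p) QY Y0.
move=> h; apply: le_trans h _; rewrite lerD2r YE.
have ns0 : 0 < n%:R * s by rewrite mulr_gt0.
apply: (@le_trans _ _ ((n%:R * s)^-1 + W / s ^+ 2)).
  rewrite ler_pdivrMr ?exprn_gt0 //; apply: le_trans Y2E _.
  rewrite le_eqVlt; apply/orP; left; apply/eqP; field.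
  by rewrite !lt0r_neq0.
apply: lerD.
  have nDR0 : 0 < n%:R * (D * (1 + Rr)) by exact: mulr_gt0.
  by rewrite lef_pV2 ?posrE //; apply: ler_wpM2l => //; exact: ltW.
apply: (@le_trans _ _ (W / (D * (1 + Rr)) ^+ 2)).
  apply: ler_wpM2l => //; rewrite lef_pV2 ?posrE ?exprn_gt0 //.
  by rewrite lerXn2r ?nnegrE ?(ltW s0) ?(ltW DR0).
have R1 : 0 < 1 + Rr by move: Rr0; lra.
rewrite ler_pdivrMr ?exprn_gt0 // /W [(D * _) ^+ 2]exprMn.
have -> : \prod_i (1 + 4 * rho i) * (ka ^+ 2 + ka / (n - 1)%:R) * (D ^+ 2 * (1 + Rr) ^+ 2) =
  D ^+ 2 * \prod_i (1 + 4 * rho i) * ((ka ^+ 2 + ka / (n - 1)%:R) * (1 + Rr) ^+ 2) by ring.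
apply: ler_wpM2l => //; rewrite /X mulrDl; apply: lerD.
  rewrite -exprMn.
  have ka1 : 1 <= ka.
    rewrite -[1]invr1 lef_pV2 ?posrE ?exprn_gt0 // -[leRHS](expr1n _ 2).
    by rewrite lerXn2r ?nnegrE ?(ltW P1) //; move: P0; lra.
  have h1 : 1 + ka * Rr <= ka * (1 + Rr) by rewrite mulrDr mulr1 lerD2r.
  have h2 : 0 <= ka * Rr by apply: mulr_ge0.
  by rewrite lerXn2r ?nnegrE // ?(le_trans _ h1) // addr_ge0.
have -> : \sum_i rho i = Rr / (n - 1)%:R.
  have -> : Rr = (n - 1)%:R * \sum_i rho i by rewrite /Rr mulr_sumr.
  by rewrite mulrAC mulfV ?mul1r ?lt0r_neq0.
have -> : ka * (Rr / (n - 1)%:R) = ka / (n - 1)%:R * Rr by rewrite mulrA mulrAC.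
apply: ler_wpM2l; first by apply: mulr_ge0 => //; rewrite invr_ge0 ltW.
have : 0 <= Rr * Rr by rewrite mulr_ge0.
rewrite expr2; move: Rr0; lra.
Qed.
End Pairs.

(** * Asymptotics *)

Lemma tail_exponent_le (R : realType) (n l P C K mu T : R) :
  0 < n -> 0 <= C -> C + 1 <= l -> 0 < K -> 96 * K <= l -> l ^+ 2 / 2 <= n ->
  0 <= P -> P * l <= (24 * K)^-1 -> T = n * (l + ln l + C) -> T + n <= mu ->
  expR (- ((mu - T) ^+ 2 / (4 * (mu * (2 + n * P))))) <= K^-1.
Proof.
move=> n0 C0 Cl K0 Kl ln2 P0 Pl TE Tmu.
have l0 : 0 < l by lra.
have l1 : 1 <= l by lra.
have lnl0 : 0 <= ln l by apply: ln_ge0.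
have lnl : ln l < l by apply: ln_sublinear.
have T0 : 0 <= T by rewrite TE; apply: mulr_ge0; [exact: ltW|lra].
have Tn : T + n <= n * (3 * l).
  have -> : T + n = n * (l + ln l + C + 1) by rewrite TE; ring.
  by rewrite ler_pM2l //; lra.
have mu0 : 0 < mu by lra.
have nP0 : 0 <= n * P by rewrite mulr_ge0 // ltW.
set Q := 4 * (mu * (2 + n * P)).
have Q0 : 0 < Q by rewrite !mulr_gt0 //; lra.
suff h : K <= (mu - T) ^+ 2 / Q.
  rewrite expRN lef_pV2 ?posrE ?expR_gt0 //.
  apply: le_trans h _; apply: le_trans (expR_ge1Dx _); by rewrite lerDr.
rewrite ler_pdivlMr //.
(* Half of [n] for each summand: [96 * K <= l] with [l ^+ 2 / 2 <= n] pays for the 2, the smallness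
   of [P * l] for [n * P]. *)
have h1 : K * (12 * l * (2 + n * P)) <= n.
  have : n * (24 * K * (P * l)) <= n * 1.
    rewrite ler_pM2l //; have K24 : 0 < 24 * K by lra.
    by rewrite mulrC -ler_pdivlMr // div1r.
  have : 96 * K * l <= l * l by rewrite ler_pM2r.
  move: ln2; rewrite expr2; lra.
(* There is no upper bound on [mu], but [(mu - T) ^+ 2 / mu] increases with [mu] beyond [T], so
   [mu = T + n] is the worst case. *)
have h2 : n ^+ 2 * mu <= (mu - T) ^+ 2 * (T + n).
  have -> : (mu - T) ^+ 2 * (T + n) = n ^+ 2 * mu +
     (mu - T - n) * (T * (mu - T + n) + n * (mu - T)) by ring.
  rewrite lerDl; apply: mulr_ge0; first by lra.
  by apply: addr_ge0; apply: mulr_ge0 => //; lra.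
have h3 : (mu - T) ^+ 2 * (T + n) <= (mu - T) ^+ 2 * (n * (3 * l)).
  by rewrite ler_wpM2l // sqr_ge0.
have h4 : n * mu <= (mu - T) ^+ 2 * (3 * l).
  rewrite -(ler_pM2l n0).
  have -> : n * (n * mu) = n ^+ 2 * mu by ring.
  apply: le_trans (le_trans h2 h3) _.
  by rewrite le_eqVlt; apply/orP; left; apply/eqP; ring.
have h5 : K * Q * (3 * l) <= n * mu.
  have -> : K * Q * (3 * l) = K * (12 * l * (2 + n * P)) * mu by rewrite /Q; ring.
  by rewrite ler_pM2r.
rewrite -(@ler_pM2r _ (3 * l)); first exact: le_trans h5 h4.
lra.
Qed.

Lemma correction_factor_le (R : realType) (P y w eta : R) :
  0 <= eta -> eta <= 1 / 20 -> 0 <= P -> P <= eta -> y <= eta -> 0 <= w -> w <= eta ->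
  expR y * (((1 - P) ^+ 2)^-1 ^+ 2 + ((1 - P) ^+ 2)^-1 * w) - 1 <= 13 * eta.
Proof.
move=> e0 e20 P0 Pe ye w0 we.
have P1 : 0 < 1 - P by lra.
set ka := ((1 - P) ^+ 2)^-1.
have k0 : 0 < ka by rewrite invr_gt0 exprn_gt0.
have ee : 0 <= eta * (1 / 20 - eta) by apply: mulr_ge0; lra.
have pp : 0 <= P * P by rewrite mulr_ge0.
have k2 : ka <= 1 + 4 * eta.
  rewrite -[leRHS]invrK lef_pV2 ?posrE ?invr_gt0 ?exprn_gt0 //; last lra.
  rewrite -(ler_pM2l (_ : 0 < 1 + 4 * eta)) ?mulfV; [|lra..].
  have -> : (1 + 4 * eta) * (1 - P) ^+ 2 = (1 + 4 * eta) * (1 - 2 * P + P * P) by ring.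
  have : (1 + 4 * eta) * (1 - 2 * eta) <= (1 + 4 * eta) * (1 - 2 * P + P * P).
    by apply: ler_wpM2l; lra.
  lra.
have kk : ka ^+ 2 <= 1 + 9 * eta.
  apply: (@le_trans _ _ ((1 + 4 * eta) ^+ 2)).
    by rewrite lerXn2r ?nnegrE ?(ltW k0) //; lra.
  rewrite expr2; lra.
have kw : ka * w <= 2 * eta by apply: ler_pM => //; [exact: ltW|lra].
have ey : expR y <= 1 + 11 / 10 * eta.
  apply: (@le_trans _ _ (expR eta)); first by rewrite ler_expR.
  have h : expR eta * (1 - eta) <= 1.
    have : expR eta * expR (- eta) = 1 by rewrite -expRD subrr expR0.
    move=> E1; rewrite -[leRHS]E1 ler_wpM2l ?expR_ge0 //; exact: expR_ge1Dx.
  rewrite -(ler_pM2r (_ : 0 < 1 - eta)); last lra.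
  apply: le_trans h _; lra.
have : expR y * (ka ^+ 2 + ka * w) <= (1 + 11 / 10 * eta) * (1 + 11 * eta).
  apply: ler_pM; rewrite ?expR_ge0 //; last lra.
  by apply: addr_ge0; [exact: sqr_ge0 | apply: mulr_ge0 => //; exact: ltW].
lra.
Qed.

Lemma one_sub_ge_expR (R : realType) (x P : R) : 0 <= x -> x <= P -> P <= 1 / 2 ->
  expR (- (x * (1 + 2 * P))) <= 1 - x.
Proof.
move=> x0 xP P2; have x1 : 0 < 1 - x by lra.
have h : (1 - x)^-1 <= expR (x * (1 + 2 * P)).
  apply: le_trans (expR_ge1Dx _).
  rewrite -(ler_pM2l x1) mulfV ?lt0r_neq0 //.
  have : 0 <= x * (P * (1 - 2 * x)) by rewrite !mulr_ge0 //; lra.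
  have : 0 <= x * (P - x) by rewrite mulr_ge0 // subr_ge0.
  lra.
rewrite expRN -[leRHS]invrK lef_pV2 ?posrE ?invr_gt0 ?expR_gt0 //.
Qed.

(** Two regimes, as [c] may fall arbitrarily fast. For [s <= l / 2] the vertices without neighbours
    are numerous enough and [1 + Rr] is discarded; otherwise [Rr] is at least [a * l / 4] and
    compensates the [ln l] in [s]. *)
Lemma low_degree_count_ge (R : realType) (l s c a Rr : R) :
  1 <= l -> s = l + ln l + c -> 0 < a -> a / 2 * s <= Rr -> 0 <= Rr ->
  (expR (l - s - 1) * (1 + Rr))^-1 <= expR (1 - l / 2) + 4 / a * expR (c + 1).
Proof.
move=> l1 sE a0 aR R0.
have l0 : 0 < l by lra.
have R1 : 0 < 1 + Rr by lra.
have a4 : 0 < a / 4 by rewrite divr_gt0.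
rewrite invfM -expRN.
have [sl|sl] := leP s (l / 2).
  apply: (@le_trans _ _ (expR (1 - l / 2))); last first.
    by rewrite lerDl mulr_ge0 ?expR_ge0 // divr_ge0 // ltW.
  rewrite -[leRHS]mulr1; apply: ler_pM; rewrite ?expR_ge0 ?invr_ge0 ?(ltW R1) //.
    by rewrite ler_expR; lra.
  by rewrite invf_le1 //; lra.
apply: (@le_trans _ _ (4 / a * expR (c + 1))); last by rewrite lerDr expR_ge0.
have -> : - (l - s - 1) = ln l + (c + 1) by rewrite sE; ring.
rewrite expRD lnK ?posrE // mulrAC ler_wpM2r ?expR_ge0 //.
rewrite ler_pdivrMr //.
have : a / 2 * (l / 2) <= a / 2 * s by apply: ler_wpM2l; [rewrite divr_ge0 // ltW | exact: ltW].
move=> h.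
have -> : l = 4 / a * (a / 2 * (l / 2)) by field; rewrite lt0r_neq0.
apply: ler_wpM2l; first by rewrite divr_ge0 // ltW.
lra.
Qed.

Lemma hamilton_prob_small (R : realType) (n m : nat) (p : 'I_m -> R) (P a c eta : R) :
  let l := ln n%:R in
  (3 <= n)%N -> 1 <= l -> (forall i, 0 <= p i <= P) -> 0 <= P -> P <= eta -> P * l <= 1 / 4 ->
  eta <= 1 / 20 -> S1 n p = n%:R * (l + ln l + c) -> c <= 0 -> 0 < a ->
  a / 2 * S1 n p <= S12 n p -> S12 n p <= 2 * a * S1 n p ->
  16 * a * l / (n - 1)%:R <= eta -> (n - 1)%:R^-1 <= eta ->
  rig_prob n p (@has_hamilton_cycle 'I_n) <=
  expR (1 - l / 2) + 4 / a * expR (c + 1) + 13 * eta.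
Proof.
move=> l n3 l1 pP P0 Pe Pl e20 S1E c0 a0 alow aup ale nle.
have nR : 0 < n%:R :> R by rewrite ltr0n (leq_trans _ n3).
have n1R : 0 < (n - 1)%:R :> R by rewrite ltr0n subn_gt0 (leq_trans _ n3).
have l0 : 0 < l by lra.
have lnl : ln l < l by apply: ln_sublinear.
have V3 : (3 <= #|'I_n|)%N by rewrite card_ord.
have P4 : P <= 1 / 4 by lra.
have := @low_degree_second_moment R 'I_n 'I_m p P pP P4 P0 V3.
rewrite card_ord -rig_prob_family => h; apply: le_trans h _.
set D := \prod_i _; set Rr := \sum_i (n - 1)%:R * _.
set H := \prod_i (1 + _).
pose s := l + ln l + c.
pose x i := p i * (1 - (1 - p i) ^+ (n - 1)).
have xE : \sum_i x i = s.
  apply: (mulfI (lt0r_neq0 nR)); rewrite -S1E mulr_sumr.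
  by apply: eq_bigr => i _; rewrite /x mulrA.
have S12E : S12 n p = n%:R * Rr.
  have E : 2 * 'C(n, 2)%:R = n%:R * (n - 1)%:R :> R.
    by have := mul_bin_diag n 1; rewrite bin1 -subn1 => hb; rewrite -!natrM -hb.
  rewrite /S12 /Rr mulr_sumr; apply: eq_bigr => i _; rewrite E; ring.
have xb i : 0 <= x i <= P.
  have /andP[h1 h2] := pP i.
  have q0 : 0 <= (1 - p i) ^+ (n - 1) by rewrite exprn_ge0 //; lra.
  have q1 : (1 - p i) ^+ (n - 1) <= 1 by rewrite exprn_ile1 //; lra.
  apply/andP; split; first by rewrite mulr_ge0 // subr_ge0.
  by apply: le_trans h2; rewrite ler_piMr // gerBl.
have s0 : 0 <= s by rewrite -xE sumr_ge0 // => i _; case/andP: (xb i).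
have s2 : s <= 2 * l by rewrite /s; lra.
have Rlow : a / 2 * s <= Rr.
  by move: alow; rewrite S1E S12E mulrCA ler_pM2l.
have Rup : Rr <= 2 * a * s.
  by move: aup; rewrite S1E S12E mulrCA ler_pM2l.
have R0 : 0 <= Rr by apply: le_trans Rlow; rewrite mulr_ge0 // divr_ge0 // ltW.
(* The error in the exponent is [2 * s * P <= 4 * l * P <= 1], so replacing the product by an
   exponential costs a factor [expR 1]. *)
have DE : expR (- (s + 1)) <= D.
  apply: (@le_trans _ _ (\prod_i expR (- (x i * (1 + 2 * P))))).
    rewrite -expR_sum ler_expR sumrN lerN2 -mulr_suml xE.
    have : s * P <= 2 * l * P by rewrite ler_wpM2r.
    lra.
  apply: ler_prod => i _; rewrite expR_ge0 /=; have /andP[h1 h2] := xb i.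
  by apply: one_sub_ge_expR => //; lra.
have HE : H <= expR (16 * a * l / (n - 1)%:R).
  apply: (@le_trans _ _ (expR (4 * (Rr / (n - 1)%:R)))).
    have -> : Rr / (n - 1)%:R = \sum_i p i ^+ 2 * (1 - p i) ^+ (n - 2).
      by rewrite /Rr -mulr_sumr mulrAC mulfV ?mul1r ?lt0r_neq0.
    rewrite mulr_sumr expR_sum; apply: ler_prod => i _; rewrite expR_ge1Dx andbT.
    have /andP[h1 h2] := pP i.
    rewrite addr_ge0 // mulr_ge0 // mulr_ge0 ?exprn_ge0 //; lra.
  rewrite ler_expR [4 * _]mulrA ler_wpM2r ?invr_ge0 ?(ltW n1R) //.
  have : 2 * a * s <= 2 * a * (2 * l) by rewrite ler_wpM2l //; lra.
  lra.
have first_term : (n%:R * (D * (1 + Rr)))^-1 <= expR (1 - l / 2) + 4 / a * expR (c + 1).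
  apply: le_trans (low_degree_count_ge l1 (erefl s) a0 Rlow R0).
  have R1 : 0 < 1 + Rr by lra.
  have D0 : 0 < D by apply: lt_le_trans DE; rewrite expR_gt0.
  rewrite lef_pV2 ?posrE ?mulr_gt0 ?expR_gt0 // mulrA ler_pM2r //.
  have -> : l - s - 1 = l + - (s + 1) by ring.
  by rewrite expRD lnK ?posrE // ler_pM2l.
have w0 : 0 <= (n - 1)%:R^-1 :> R by rewrite invr_ge0 ltW.
have e0 : 0 <= eta by lra.
have := correction_factor_le e0 e20 P0 Pe ale w0 nle.
set ka := ((1 - P) ^+ 2)^-1 => hc.
have ka0 : 0 <= ka by rewrite invr_ge0 sqr_ge0.
have hH : H * (ka ^+ 2 + ka / (n - 1)%:R) <= expR (16 * a * l / (n - 1)%:R) * (ka ^+ 2 + ka / (n - 1)%:R).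
  by apply: ler_wpM2r => //; apply: addr_ge0; [exact: sqr_ge0 | exact: mulr_ge0].
rewrite -addrA; apply: lerD => //; lra.
Qed.

Lemma hamilton_prob_large (R : realType) (n m : nat) (p : 'I_m -> R) (P C C' c eps : R) :
  let l := ln n%:R in
  (0 < n)%N -> 0 < eps -> (forall i, 0 <= p i <= P) -> 0 <= P -> P <= 1 ->
  (forall bl : seq bool, n%:R * (l + ln l + C) <= (\sum_(b <- bl) (2 + b))%N%:R ->
    avgl (size bl) (fun t => (~~ has_hamilton_cycle (block_graph (blocks bl t) : rel 'I_n))%:R) <= eps) ->
  C <= C' -> 0 <= C' -> C' + 1 <= l -> 96 / eps <= l -> l ^+ 2 / 2 <= n%:R ->
  P * l <= eps / 24 -> S1 n p = n%:R * (l + ln l + c) -> C' + 1 <= c ->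
  1 - rig_prob n p (@has_hamilton_cycle 'I_n) <= 2 * eps.
Proof.
move=> l n0 e0 pP P0 P1 H CC' C'0 Cl el ln2 Pl S1E cC.
have nR : 0 < n%:R :> R by rewrite ltr0n.
have l0 : 0 < l by lra.
have l1 : 1 <= l by lra.
have lnl0 : 0 <= ln l by apply: ln_ge0.
have -> : 1 - rig_prob n p (@has_hamilton_cycle 'I_n) =
  \sum_(A : {ffun 'I_m -> {set 'I_n}}) family_law p A * (~~ has_hamilton_cycle (family_graph A))%:R.
  rewrite rig_prob_family -[X in X - _](family_law_sum1 'I_n p) -sumrB; apply: eq_bigr => A _.
  by case: (has_hamilton_cycle (family_graph A)); rewrite /= ?mulr1n ?mulr0n ?mulr1 ?mulr0 ?subrr ?subr0.
pose T := n%:R * (l + ln l + C').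
have V0 : (0 < #|'I_n|)%N by rewrite card_ord.
have HT (bl : seq bool) : T <= (\sum_(b <- bl) (2 + b))%N%:R ->
  avgl (size bl) (fun t => (~~ has_hamilton_cycle (block_graph (blocks bl t) : rel 'I_n))%:R) <= eps.
  move=> hb; apply: H; apply: le_trans hb; rewrite ler_pM2l //; lra.
have := @nonhamiltonian_prob_le R 'I_n 'I_m p P eps T V0 (ltW e0) pP P1 HT.
rewrite /= card_ord -/(S1 n p) => h.
have Tmu : T + n%:R <= S1 n p.
  have -> : T + n%:R = n%:R * (l + ln l + C' + 1) by rewrite /T; ring.
  by rewrite S1E ler_pM2l //; lra.
have T0 : 0 <= T by rewrite mulr_ge0 // ?(ltW nR) //; lra.
have mu0 : 0 < S1 n p by lra.
have Tmu' : T <= S1 n p by lra.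
apply: le_trans (h mu0 Tmu') _.
have -> : 2 * eps = eps + eps by ring.
rewrite lerD2l.
have K0 : 0 < eps^-1 by rewrite invr_gt0.
have Pl' : P * l <= (24 * eps^-1)^-1 by rewrite invfM invrK [24^-1 * _]mulrC.
rewrite -[leRHS]invrK.
exact: (tail_exponent_le nR C'0 Cl K0 el ln2 P0 Pl' (erefl T) Tmu).
Qed.

From mathcomp Require Import all_classical all_reals all_analysis.
Import numFieldNormedType.Exports.
Local Open Scope classical_set_scope.

Lemma near_le_ln (R : realType) (M : R) : \forall n \near \oo, M <= ln n%:R.
Proof.
have := nbhs_infty_ger (expR M); apply: filterS => n h.
by rewrite -[M]expRK ler_ln ?posrE ?expR_gt0 // (lt_le_trans _ h) ?expR_gt0.
Qed.

Lemma expR_half_le_near (R : realType) (e : R) : 0 < e ->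
  \forall n \near \oo, expR (1 - ln n%:R / 2) <= e :> R.
Proof.
move=> e0; apply: filterS (near_le_ln (2 - 2 * ln e)) => n h.
by rewrite -[leRHS]lnK ?posrE // ler_expR; lra.
Qed.

Theorem theorem4 (R : realType) (m : nat -> nat)
    (p : forall n : nat, 'I_(m n) -> R) (c : nat -> R)
    (p01 : forall (n : nat) (i : 'I_(m n)), 0 < p n i < 1)
    (pmax : (fun n : nat => \big[Num.max/0]_(i < m n) p n i)
              =o_\oo (fun n : nat => (ln n%:R)^-1))
    (S1E : forall n : nat, (2 <= n)%N ->
       S1 n (p n) = n%:R * (ln n%:R + ln (ln n%:R) + c n)) :
  (forall a : R, 0 < a <= 1 ->
     c n @[n --> \oo] --> -oo ->
     S12 n (p n) / S1 n (p n) @[n --> \oo] --> a ->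
     rig_prob n (p n) (@has_hamilton_cycle 'I_n) @[n --> \oo] --> (0 : R))
  /\
  (c n @[n --> \oo] --> +oo ->
   rig_prob n (p n) (@has_hamilton_cycle 'I_n) @[n --> \oo] --> (1 : R)).
Proof.
pose P n : R := \big[Num.max/0]_(i < m n) p n i.
have P0 n : 0 <= P n by apply: bigmax_ge_id.
have pP n i : 0 <= p n i <= P n.
  by case/andP: (p01 n i) => h _; rewrite (ltW h) /=; apply: le_bigmax.
have Psmall (d : R) : 0 < d -> \forall n \near \oo, P n * ln n%:R <= d.
  move=> d0; move/eqoP: pmax => /(_ d d0) h.
  near=> n.
  have l1 : 1 <= ln n%:R :> R by near: n; exact: near_le_ln.
  have l0 : 0 < ln n%:R :> R by lra.
  have : `|P n| <= d * `|(ln n%:R)^-1 : R| by near: n; exact: h.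
  rewrite ger0_norm // gtr0_norm ?invr_gt0 // => h'.
  by rewrite -ler_pdivlMr.
have prob_ge0 n : 0 <= rig_prob n (p n) (@has_hamilton_cycle 'I_n).
  rewrite rig_prob_family; apply: sumr_ge0 => A _; rewrite mulr_ge0 //.
  by apply: family_law_ge0 => i; case/andP: (p01 n i) => h1 h2; rewrite !ltW.
have prob_le1 n : rig_prob n (p n) (@has_hamilton_cycle 'I_n) <= 1.
  rewrite rig_prob_family -[leRHS](family_law_sum1 'I_n (p n)); apply: ler_sum => A _.
  rewrite ler_piMr ?lern1 ?leq_b1 //.
  by apply: family_law_ge0 => i; case/andP: (p01 n i) => h1 h2; rewrite !ltW.
split.
  move=> a /andP[a0 a1] cNy aE; apply/cvgrPdist_le => eps eps0.
  (* [hamilton_prob_small] leaves [13 * eta], which has to be at most [eps / 3]. *)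
  pose eta := Num.min (1 / 20) (eps / 39) : R.
  have eta0 : 0 < eta by rewrite lt_min !divr_gt0.
  have eta20 : eta <= 1 / 20 by rewrite ge_min lexx.
  have eta39 : eta <= eps / 39 by rewrite ge_min lexx orbT.
  near=> n.
  rewrite sub0r normrN ger0_norm //.
  (* Since [l ^+ 2 <= 4 * (n - 1)], these thresholds yield [(n - 1)^-1 <= eta] and
     [16 * a * l / (n - 1) <= eta]. *)
  have l1 : Num.max 1 (Num.max (4 / eta) (64 * a / eta)) <= ln n%:R :> R.
    by near: n; exact: near_le_ln.
  move: l1; rewrite !ge_max => /and3P[l1 l2 l3].
  set l := ln n%:R : R; rewrite -/l in l1 l2 l3.
  have l0 : 0 < l by lra.
  have n3 : (3 <= n)%N by near: n; exact: nbhs_infty_ge.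
  have nR : 0 < n%:R :> R by rewrite ltr0n (leq_trans _ n3).
  have n3R : 3 <= n%:R :> R by rewrite ler_nat.
  have nl : l ^+ 2 / 2 <= n%:R.
    by rewrite -[leRHS]lnK ?posrE //; apply: le_trans (expR_ge1Dxn 1 (ltW l0)); rewrite lerDr.
  have Pl : P n * ln n%:R <= Num.min eta (1 / 4) by near: n; apply: Psmall; rewrite lt_min eta0 divr_gt0.
  have [Pe P4] : P n * l <= eta /\ P n * l <= 1 / 4 by apply/andP; rewrite -le_min.
  have Peta : P n <= eta.
    by apply: le_trans Pe; rewrite ler_peMr.
  (* The logarithm is chosen to make [4 / a * expR (c n + 1)] at most [eps / 3]. *)
  have cn : c n <= Num.min 0 (ln (a * eps / 12) - 1) by near: n; exact: (cvgrNyPle _).1.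
  have [c0 ce] : c n <= 0 /\ c n <= ln (a * eps / 12) - 1 by apply/andP; rewrite -le_min.
  have alow : a / 2 <= S12 n (p n) / S1 n (p n).
    by near: n; apply: cvgr_ge aE _ _; lra.
  have aup : S12 n (p n) / S1 n (p n) <= 2 * a.
    by near: n; apply: cvgr_le aE _ _; lra.
  (* Were [S1] zero, the quotient would be 0 by convention, against its lower bound [a / 2]. *)
  have S1p : 0 < S1 n (p n).
    rewrite lt_neqAle eq_sym; apply/andP; split.
      by apply/eqP => S10; move: alow; rewrite S10 invr0 mulr0; lra.
    apply: sumr_ge0 => i _; case/andP: (p01 n i) => h1 h2.
    by rewrite !mulr_ge0 ?(ltW h1) // subr_ge0 exprn_ile1 //; lra.
  have n1 : n%:R / 2 <= (n - 1)%:R :> R.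
    by rewrite natrB ?(leq_trans _ n3) //; lra.
  have n1p : 0 < (n - 1)%:R :> R by lra.
  have l2n : l * l <= 4 * (n - 1)%:R by move: nl; rewrite expr2; lra.
  have e2l : 4 <= eta * l by move: l2; rewrite ler_pdivrMr // [l * eta]mulrC.
  have e3l : 64 * a <= eta * l by move: l3; rewrite ler_pdivrMr // [l * eta]mulrC.
  have h1 : 16 * a * l / (n - 1)%:R <= eta.
    rewrite ler_pdivrMr //.
    have : 64 * a * l <= eta * l * l by rewrite ler_pM2r.
    have : eta * (l * l) <= eta * (4 * (n - 1)%:R) by rewrite ler_pM2l.
    lra.
  have h2 : (n - 1)%:R^-1 <= eta.
    rewrite -div1r ler_pdivrMr //.
    have : eta * l * 1 <= eta * l * l by rewrite ler_pM2l ?mulr_gt0.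
    have : eta * (l * l) <= eta * (4 * (n - 1)%:R) by rewrite ler_pM2l.
    lra.
  have aup' : S12 n (p n) <= 2 * a * S1 n (p n) by rewrite -ler_pdivrMr.
  have alow' : a / 2 * S1 n (p n) <= S12 n (p n) by rewrite -ler_pdivlMr.
  have n2 : (2 <= n)%N by rewrite ltnW.
  have := hamilton_prob_small n3 l1 (pP n) (P0 n) Peta P4 eta20 (S1E n n2) c0 a0 alow' aup' h1 h2.
  rewrite -/l => h; apply: le_trans h _.
  have t1 : expR (1 - ln n%:R / 2) <= eps / 3.
    by near: n; apply: expR_half_le_near; rewrite divr_gt0.
  have t2 : 4 / a * expR (c n + 1) <= eps / 3.
    have : expR (c n + 1) <= a * eps / 12.
      have ae : 0 < a * eps / 12 by rewrite divr_gt0 // mulr_gt0.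
      by rewrite -[leRHS]lnK ?posrE // ler_expR; lra.
    move=> ht; have a4 : 0 <= 4 / a by rewrite divr_ge0 // ltW.
    apply: le_trans (ler_wpM2l a4 ht) _.
    rewrite le_eqVlt; apply/orP; left; apply/eqP; field; exact: lt0r_neq0.
  by rewrite -/l in t1; lra.
move=> cy; apply/cvgrPdist_le => eps eps0.
(* Half for the random blocks, half for a shortage of slots. *)
have e2 : 0 < eps / 2 by rewrite divr_gt0.
have [C [M CM]] := blocks_hamiltonian e2.
pose C' := Num.max 0 C.
have CC' : C <= C' by rewrite le_max lexx orbT.
have C'0 : 0 <= C' by rewrite le_max lexx.
near=> n.
rewrite ger0_norm ?subr_ge0 //.
have l1 : Num.max 1 (Num.max M (Num.max (C' + 1) (96 / (eps / 2)))) <= ln n%:R :> R.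
  by near: n; exact: near_le_ln.
move: l1; rewrite !ge_max => /and4P[l1 l2 l3 l4].
have n2 : (2 <= n)%N by near: n; exact: nbhs_infty_ge.
have n0 : (0 < n)%N by rewrite ltnW.
have nR : 0 < n%:R :> R by rewrite ltr0n.
have l0 : 0 <= ln n%:R :> R by lra.
have nl : (ln n%:R) ^+ 2 / 2 <= n%:R :> R.
  by rewrite -[leRHS]lnK ?posrE //; apply: le_trans (expR_ge1Dxn 1 l0); rewrite lerDr.
have Pl : P n * ln n%:R <= Num.min 1 (eps / 2 / 24).
  by near: n; apply: Psmall; rewrite lt_min ltr01 divr_gt0.
have [Pl1 Ple] : P n * ln n%:R <= 1 /\ P n * ln n%:R <= eps / 2 / 24 by apply/andP; rewrite -le_min.
have P1 : P n <= 1 by apply: le_trans Pl1; rewrite ler_peMr.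
have cn : C' + 1 <= c n by near: n; exact: (cvgryPge _).1.
have H (bl : seq bool) : n%:R * (ln n%:R + ln (ln n%:R) + C) <= (\sum_(b <- bl) (2 + b))%N%:R ->
    avgl (size bl) (fun t => (~~ has_hamilton_cycle (block_graph (blocks bl t) : rel 'I_n))%:R) <= eps / 2.
  by have := CM 'I_n bl; rewrite card_ord => h; apply: h.
have := hamilton_prob_large n0 e2 (pP n) (P0 n) P1 H CC' C'0 l3 l4 nl Ple (S1E n n2) cn.
by rewrite mulrCA mulfV ?mulr1.
Unshelve. all: by end_near.
Qed.
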